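(* Let $X$ be a uniform space and $G$ an internal abelian group. If $X$ is chain-connected, then $\tilde H_0(X;G)=0$.
   Context: Nonstandard setting: fix a standard universe $\mathbb{U}$ satisfying sufficiently many axioms of ZFC and containing all standard objects considered (uniform spaces are standard), and an elementary extension ${}^{\ast}\mathbb{U}$ of $\mathbb{U}$ (the internal universe) that is $|\mathbb{U}|^{+}$-saturated; $x\mapsto{}^{\ast}x$ is the elementary embedding. ''Internal'' means belonging to ${}^{\ast}\mathbb{U}$; ''hyperfinite'' means finite in the sense of ${}^{\ast}\mathbb{U}$. For a uniform space $X$, points $x,y\in{}^{\ast}X$ are infinitely close, $x\approx y$, if $(x,y)\in{}^{\ast}U$ for every entourage $U$ of $X$. $\mu$-chains: $C_p(X;G)$ is the internal abelian group of hyperfinite formal sums $\sum_{i=0}^{n}g_i\sigma_i$ with $\{g_i\}_{i=0}^n$ and $\{\sigma_i\}_{i=0}^n$ internal hyperfinite sequences in $G$ and in ${}^{\ast}X^{p+1}$ respectively (equivalently, internal functions ${}^{\ast}X^{p+1}\to G$ with hyperfinite support). A $p$-microsimplex is $(a_0,\ldots,a_p)\in{}^{\ast}X^{p+1}$ with $a_i\approx a_j$ for all $i,j\le p$. $M_p(X;G)\subseteq C_p(X;G)$ is the subgroup of $p$-microchains, i.e. elements representable as $\sum_{i=0}^n g_i\sigma_i$ with $\{g_i\}$, $\{\sigma_i\}$ internal hyperfinite sequences and every $\sigma_i$ a $p$-microsimplex. The boundary $\partial_p:M_p(X;G)\to M_{p-1}(X;G)$ is the restriction of the internal homomorphism determined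 by $\partial_p(a_0,\ldots,a_p)=\sum_{i=0}^p(-1)^i(a_0,\ldots,\hat a_i,\ldots,a_p)$. Reduced $\mu$-homology $\tilde H_\bullet(X;G)$ is the homology of the augmented complex $G\xleftarrow{\varepsilon}M_0(X;G)\xleftarrow{\partial_1}M_1(X;G)\xleftarrow{\partial_2}\cdots$, where $\varepsilon\left(\sum_i g_i\sigma_i\right)=\sum_i g_i$; so $\tilde H_0(X;G)=\ker\varepsilon/\mathrm{im}\,\partial_1$. A uniform space $X$ is chain-connected if for every entourage $U$ of $X$ and all $x,y\in X$ there is a finite sequence $x_0,\ldots,x_n$ in $X$ with $x_0=x$, $x_n=y$ and $(x_i,x_{i+1})\in U$ for all $i<n$. *)

(* Defs.v *)
From HB Require Import structures.
From mathcomp Require Import all_boot all_order all_algebra.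
From mathcomp Require Import all_classical all_reals all_analysis.

Set Implicit Arguments.
Unset Strict Implicit.
Unset Printing Implicit Defensive.

Import GRing.Theory.
Local Open Scope classical_set_scope.
Local Open Scope ring_scope.
Local Open Scope card_scope.

Record set_structure := SetStructure {
  points :> choiceType;
  elem : points -> points -> Prop }.

Notation "x ∈ a" := (elem x a) (at level 70, no associativity).

Definition El (S : set_structure) (a : S) : Type := {x : S | x ∈ a}.

Definition El_val (S : set_structure) (a : S) (x : El a) : S := proj1_sig x.

(* First-order formulas in the language {∈, =}, with de Bruijn indices. *)
Inductive formula : Type :=
| FMem of nat & nat
| FEq of nat & nat
| FNot of formula
| FAnd of formula & formula
| FEx of formula.

Definition scons (T : Type) (x : T) (e : nat -> T) (n : nat) : T :=
  if n is m.+1 then e m else x.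

Fixpoint sat (S : set_structure) (e : nat -> S) (f : formula) : Prop :=
  match f with
  | FMem i j => e i ∈ e j
  | FEq i j => e i = e j
  | FNot g => ~ sat e g
  | FAnd g h => sat e g /\ sat e h
  | FEx g => exists x : S, sat (scons x e) g
  end.

Definition is_empty (S : set_structure) (z : S) : Prop := forall w, ~ w ∈ z.

Definition is_succ (S : set_structure) (y x : S) : Prop :=
  forall w, w ∈ y <-> w ∈ x \/ w = x.

Definition inductive_set (S : set_structure) (w : S) : Prop :=
  (forall z, is_empty z -> z ∈ w) /\
  (forall x y, x ∈ w -> is_succ y x -> y ∈ w).

(* Being a natural number in the sense of [S]. *)
Definition natural (S : set_structure) (n : S) : Prop :=
  forall w, inductive_set w -> n ∈ w.

(* Unordered and Kuratowski ordered pairs; the default value of [xget] is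
   irrelevant in models of pairing. *)
Definition upair (S : set_structure) (x y : S) : S :=
  xget x [set z : S | forall w, w ∈ z <-> w = x \/ w = y].

Definition opair (S : set_structure) (x y : S) : S :=
  upair (upair x x) (upair x y).

(* The fragment of ZFC required of the standard universe: Zermelo's axioms,
   separation being the first-order schema with parameters. *)
Record zermelo (S : set_structure) : Prop := Zermelo {
  z_extensionality : forall x y : S, (forall z, z ∈ x <-> z ∈ y) -> x = y;
  z_pairing : forall x y : S, exists z, forall w, w ∈ z <-> w = x \/ w = y;
  z_union : forall x : S, exists z, forall w, w ∈ z <-> exists2 y, y ∈ x & w ∈ y;
  z_powerset : forall x : S, exists z, forall w,
    w ∈ z <-> (forall v, v ∈ w -> v ∈ x);
  z_infinity : exists w : S, inductive_set w /\ exists z, is_empty z /\ z ∈ w;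
  z_separation : forall (f : formula) (e : nat -> S) (x : S),
    exists z, forall w, w ∈ z <-> w ∈ x /\ sat (scons w e) f }.

Definition elementary (S S' : set_structure) (j : S -> S') : Prop :=
  forall (f : formula) (e : nat -> S), sat e f <-> sat (j \o e) f.

(* |U|^+-saturation: a 1-type with parameters in a set of cardinality at most
   |U| is realized as soon as it is finitely satisfiable.  A member (f, e) of
   the type is the formula f in the variable of index 0, the other variables
   being interpreted by the parameters e. *)
Definition saturated (U : Type) (S : set_structure) : Prop :=
  forall (A : set S) (p : set (formula * (nat -> S))),
    A #<= [set: U] ->
    (forall q, p q -> forall n, A (q.2 n)) ->
    (forall p0, p0 `<=` p -> finite_set p0 ->
       exists x : S, forall q, p0 q -> sat (scons x q.2) q.1) ->
    exists x : S, forall q, p q -> sat (scons x q.2) q.1.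

Record nonstandard_framework := NonstandardFramework {
  standard : set_structure;
  internal : set_structure;
  star : standard -> internal;
  standard_zermelo : zermelo standard;
  star_elementary : elementary star;
  internal_saturated : saturated standard internal }.

(* [a] is the set, in the sense of [S], of the codes of the elements of [A]. *)
Definition is_code (S : set_structure) (T : Type) (c : T -> S) (A : set T)
    (a : S) : Prop :=
  forall z, z ∈ a <-> exists2 x, A x & z = c x.

(* [f] belongs to [S], the elements of [A] and [B] being coded by [cA], [cB]. *)
Definition internal_map (S : set_structure) (A B : Type) (cA : A -> S)
    (cB : B -> S) (f : A -> B) : Prop :=
  exists a, is_code (fun x => opair (cA x) (cB (f x))) [set: A] a.

(* The uniform space [X] belongs to the universe [S]: its underlying set, each
   of its entourages and the set of its entourages are elements of [S]. *)
Record uniform_in (S : set_structure) (X : uniformType) := UniformIn {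
  pt : X -> S;
  pt_inj : injective pt;
  space : S;
  spaceP : is_code pt [set: X] space;
  ent : set (X * X) -> S;
  entP : forall E, entourage E ->
    is_code (fun xy => opair (pt xy.1) (pt xy.2)) E (ent E);
  uniformity : S;
  uniformityP : is_code ent entourage uniformity }.

(* The abelian group [G] belongs to [S]: its underlying set and its addition
   are elements of [S]. *)
Record abelian_group_in (S : set_structure) (G : zmodType) := AbelianGroupIn {
  gpt : G -> S;
  gpt_inj : injective gpt;
  gset : S;
  gsetP : is_code gpt [set: G] gset;
  gadd : internal_map (fun gh : G * G => opair (gpt gh.1) (gpt gh.2)) gpt
           (fun gh => gh.1 + gh.2) }.

Definition chain_connected (X : uniformType) : Prop :=
  forall E : set (X * X), entourage E -> forall x y : X,
    exists (n : nat) (s : nat -> X),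
      [/\ s 0%N = x, s n = y & forall i, (i < n)%N -> E (s i, s i.+1)].

Section MuHomology.
Variables (F : nonstandard_framework) (X : uniformType).
Variables (cX : uniform_in (standard F) X).
Variables (G : zmodType) (cG : abelian_group_in (internal F) G).

Definition starX : Type := El (star (space cX)).

Definition infinitely_close (x y : starX) : Prop :=
  forall E : set (X * X), entourage E ->
    opair (El_val x) (El_val y) ∈ star (ent cX E).

Definition simplex (p : nat) : Type := p.+1.-tuple starX.

Definition simplex_code (p : nat) (t : simplex p) : internal F :=
  foldl (@opair (internal F)) (El_val (thead t))
    [seq El_val x | x <- behead t].

Definition microsimplex (p : nat) (t : simplex p) : Prop :=
  forall i j, infinitely_close (tnth t i) (tnth t j).

Definition face (p : nat) (i : 'I_p.+2) (t : simplex p.+1) : simplex p :=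
  [tuple tnth t (lift i j) | j < p.+1].

(* Hyperfinite sequences are indexed by the elements {0, ..., n - 1} of a
   natural number n of the internal universe. *)
Definition internal_seq (n : internal F) (g : El n -> G) : Prop :=
  internal_map (@El_val _ n) (gpt cG) g.

Definition internal_simplex_seq (p : nat) (n : internal F)
    (s : El n -> simplex p) : Prop :=
  internal_map (@El_val _ n) (@simplex_code p) s.

(* [v] is the sum of the hyperfinite sequence [g], i.e. the last term of the
   internal sequence [u] of its partial sums. *)
Definition hyperfinite_sum (n : internal F) (g : El n -> G) (v : G) : Prop :=
  exists (u : internal F -> G) (n' : internal F),
    [/\ is_succ n' n /\ internal_seq (fun k : El n' => u (El_val k)),
        forall z, is_empty z -> u z = 0,
        forall (k : El n) k', is_succ k' (El_val k) ->
          u k' = u (El_val k) + g k &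
        v = u n].

Definition chain (p : nat) : Type := simplex p -> G.

Definition single (p : nat) (g : G) (s : simplex p) : chain p :=
  fun t => if `[< t = s >] then g else 0.

(* [c] is the chain given by the formal sum of the g_k s_k over k < n. *)
Definition formal_sum (p : nat) (n : internal F) (g : El n -> G)
    (s : El n -> simplex p) (c : chain p) : Prop :=
  [/\ natural n, internal_seq g, internal_simplex_seq s &
      forall t, hyperfinite_sum (fun k => single (g k) (s k) t) (c t)].

Definition microchains (p : nat) : set (chain p) :=
  [set c | exists n g s,
     @formal_sum p n g s c /\ forall k, microsimplex (s k)].

(* The sum of the phi(s_k, g_k), where [c] is the formal sum of the g_k s_k.
   For [phi] internal and additive in its second argument, this is independent
   of the way [c] is written as a formal sum. *)
Definition linear_extension (p : nat) (phi : simplex p -> G -> G)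
    (c : chain p) : G :=
  xget 0 [set v | exists n g s,
    @formal_sum p n g s c /\ hyperfinite_sum (fun k => phi (s k) (g k)) v].

Definition augmentation (c : chain 0) : G :=
  linear_extension (fun _ g => g) c.

Definition simplex_boundary (p : nat) (g : G) (s : simplex p.+1) : chain p :=
  fun t => \sum_(i < p.+2) single g (face i s) t *~ (-1) ^+ i.

Definition boundary (p : nat) (c : chain p.+1) : chain p :=
  fun t => linear_extension (fun s g => simplex_boundary g s t) c.

Definition reduced_cycles (p : nat) : set (chain p) :=
  match p with
  | 0 => [set c | microchains c /\ augmentation c = 0]
  | q.+1 => [set c | microchains c /\ boundary c = 0]
  end.

Definition boundaries (p : nat) : set (chain p) :=
  @boundary p @` @microchains p.+1.

Definition homology_class (p : nat) (c : chain p) : set (chain p) :=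
  [set c + b | b in @boundaries p].

(* Elements of the quotient group are represented as cosets. *)
Definition reduced_homology (p : nat) : set (set (chain p)) :=
  @homology_class p @` @reduced_cycles p.

End MuHomology.

Arguments homology_class [F X] cX [G] cG [p] c _.
Arguments reduced_homology [F X] cX [G] cG p _.

(* Main.v *)
Require Import Defs.
From mathcomp Require Import all_boot all_order all_algebra.
From mathcomp Require Import all_classical all_reals all_analysis.
Import GRing.Theory.
Local Open Scope classical_set_scope.
Local Open Scope ring_scope.

Set Implicit Arguments.
Unset Strict Implicit.
Unset Printing Implicit Defensive.

(** Saturation yields an internal entourage W contained in every standard one,
    hence in the relation of being infinitely close, and by transfer any two
    points of *X are joined by an internal chain of W-steps: an internal set
    containing one point and closed under W-steps is all of *X.  The telescoping
    sum of g times the steps of a chain from x to y is a microchain with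
    boundary g y - g x, so an induction over a hyperfinite formal sum
    c = sum_(k < n) g_k s_k of points shows that c - (sum_(k < n) g_k) x0 is a
    boundary; when the augmentation of c vanishes, c itself is a boundary.

    All inductions take place inside the internal universe, so each property
    inducted upon has to be definable there. *)

(** * Definability with parameters *)

Section Renaming.
Variable S : set_structure.
Implicit Types (e : nat -> S) (f : formula).

(** Infinite closeness quantifies over the standard entourages from outside, so it is external, and
    being the boundary of a microchain is not a property that internal induction can handle. It is
    replaced by [bounds R] for a definable relation [R] contained in closeness; closeness itself is
    recovered only once the induction is over. A second obstacle is that [linear_extension] selects
    its value by choice: augmentation and boundary become computable only after two formal sums of
    one chain are shown to have the same image. Finally, neither replacement nor a recursion theorem
    is at hand in the internal universe, so graphs and partial sums are built by adjoining one pair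
    at a time. *)

Definition lift_renaming (r : nat -> nat) (i : nat) : nat :=
  if i is k.+1 then (r k).+1 else 0%N.

Fixpoint rename (r : nat -> nat) (f : formula) : formula :=
  match f with
  | FMem i j => FMem (r i) (r j)
  | FEq i j => FEq (r i) (r j)
  | FNot g => FNot (rename r g)
  | FAnd g h => FAnd (rename r g) (rename r h)
  | FEx g => FEx (rename (lift_renaming r) g)
  end.

Lemma sat_rename f r e : sat e (rename r f) <-> sat (e \o r) f.
Proof.
elim: f r e => [i j|i j|g IH|g IHg h IHh|g IH] r e //=.
- by rewrite IH.
- by rewrite IHg IHh.
- suff H x : sat (scons x e) (rename (lift_renaming r) g) <->
      sat (scons x (e \o r)) g by split=> -[x /H gx]; exists x.
  rewrite IH; suff -> : scons x e \o lift_renaming r = scons x (e \o r) by [].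
  by apply/funext => -[|k].
Qed.

End Renaming.

(* [definable P] means that P is given by a formula whose variables stand
   either for entries of the environment or for arbitrary parameters. *)
Section Definable.
Variable S : set_structure.
Local Notation env := (nat -> S).
Implicit Types (P Q : env -> Prop) (t u : env -> S).

Definition lookup (e : env) (i : nat + S) : S :=
  match i with inl k => e k | inr a => a end.

Definition definable P : Prop :=
  exists f (r : nat -> nat + S), forall e, P e <-> sat (lookup e \o r) f.

(** The language has no function symbols, so a term is given by its graph, with the value in slot 0;
    substituting it into a formula costs an existential quantifier. *)
Definition definable_term t : Prop :=
  definable (fun e => e 0%N = t (fun n => e n.+1)).

Lemma definable_ext P Q :
  (forall e, P e <-> Q e) -> definable P -> definable Q.
Proof. by move=> PQ [f [r Pf]]; exists f, r => e; rewrite -PQ Pf. Qed.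

(** Weakening, exchange of variables and freezing a slot at a parameter are all instances. *)
Lemma definable_reindex P (r : nat -> nat + S) :
  definable P -> definable (fun e => P (lookup e \o r)).
Proof.
move=> [f [r' Pf]].
exists f, (fun i => match r' i with inl k => r k | inr a => inr a end) => e.
rewrite Pf; suff -> : lookup (lookup e \o r) \o r' =
  lookup e \o (fun i => match r' i with inl k => r k | inr a => inr a end) by [].
by apply/funext => i /=; case: (r' i).
Qed.

Lemma definable_not P : definable P -> definable (fun e => ~ P e).
Proof. by move=> [f [r Pf]]; exists (FNot f), r => e /=; rewrite Pf. Qed.

Lemma definable_and P Q :
  definable P -> definable Q -> definable (fun e => P e /\ Q e).
Proof.
move=> [f [r Pf]] [g [r' Qg]].
(* Each formula may come with infinitely many parameters: those of [f] are moved to the even slots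
   and those of [g] to the odd ones. *)
exists (FAnd (rename double f) (rename (fun i => i.*2.+1) g)),
  (fun i => if odd i then r' i./2 else r i./2) => e /=.
rewrite !sat_rename Pf Qg.
have -> : (lookup e \o (fun i => if odd i then r' i./2 else r i./2)) \o double
  = lookup e \o r by apply/funext => i /=; rewrite odd_double doubleK.
by have -> : (lookup e \o (fun i => if odd i then r' i./2 else r i./2))
  \o (fun i => i.*2.+1) = lookup e \o r'
  by apply/funext => i /=; rewrite odd_double /= uphalf_double.
Qed.

Lemma definable_ex (P : S -> env -> Prop) :
  definable (fun e => P (e 0%N) (fun n => e n.+1)) ->
  definable (fun e => exists x, P x e).
Proof.
move=> [f [r Pf]].
(* The quantified variable must have index 0, whereas [r] may send several indices to slot 0: these
   are merged into 0, and all others are shifted past the binder. *)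
exists (FEx (rename (fun i => if r i is inl 0%N then 0%N else i.+1) f)),
  (fun i => match r i with inl k => inl k.-1 | inr a => inr a end) => e /=.
suff H x : P x e <-> sat (scons x (lookup e \o
    (fun i => match r i with inl k => inl k.-1 | inr a => inr a end)))
  (rename (fun i => if r i is inl 0%N then 0%N else i.+1) f).
  by split=> -[x xP]; exists x; apply/H.
rewrite sat_rename (Pf (scons x e)) /=.
set e1 := (X in sat X f <-> _); set e2 := (X in _ <-> sat X f).
suff -> : e1 = e2 by [].
apply/funext => i; rewrite /e1 /e2 /=.
by case E : (r i) => [[|k]|a] //=; rewrite ?E.
Qed.

(** By excluded middle a proposition that ignores the environment is equivalent to a constant,
    whatever its own complexity. *)
Lemma definable_prop (A : Prop) : definable (fun _ => A).
Proof.
have D0 : definable (fun _ => True).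
  exists (FNot (FAnd (FEq 0 0) (FNot (FEq 0 0)))), inl => e /=.
  by split=> // _ [].
have [a|na] := pselect A; first by apply: definable_ext D0.
by apply: definable_ext (definable_not D0) => e; split=> // /(_ I).
Qed.

Lemma definable_or P Q :
  definable P -> definable Q -> definable (fun e => P e \/ Q e).
Proof.
move=> /definable_not DP /definable_not DQ.
apply: definable_ext (definable_not (definable_and DP DQ)) => e.
by split=> [/not_andP[/contrapT|/contrapT]|[p|q] []]; [left|right| |].
Qed.

Lemma definable_imp P Q :
  definable P -> definable Q -> definable (fun e => P e -> Q e).
Proof.
move=> /definable_not DP DQ; apply: definable_ext (definable_or DP DQ) => e.
by split=> [[//|q _ //]|PQ]; have [p|] := pselect (P e); [right; apply: PQ|left].
Qed.

Lemma definable_and3 P Q (T : env -> Prop) :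
  definable P -> definable Q -> definable T ->
  definable (fun e => [/\ P e, Q e & T e]).
Proof.
move=> DP DQ DT; apply: definable_ext (definable_and DP (definable_and DQ DT)) => e.
by split=> [[? []]|[]].
Qed.

Lemma definable_iff P Q :
  definable P -> definable Q -> definable (fun e => P e <-> Q e).
Proof. by move=> DP DQ; apply: definable_and; apply: definable_imp. Qed.

Lemma definable_all (P : S -> env -> Prop) :
  definable (fun e => P (e 0%N) (fun n => e n.+1)) ->
  definable (fun e => forall x, P x e).
Proof.
move=> /definable_not /(@definable_ex (fun x e => ~ P x e)) /definable_not.
apply: definable_ext => e; split=> [/forallNP H x|H [x]]; last exact.
exact: contrapT (H x).
Qed.

Lemma definable_ex2 (P Q : S -> env -> Prop) :
  definable (fun e => P (e 0%N) (fun n => e n.+1)) ->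
  definable (fun e => Q (e 0%N) (fun n => e n.+1)) ->
  definable (fun e => exists2 x, P x e & Q x e).
Proof.
move=> DP DQ.
apply: definable_ext (definable_ex (P := fun x e => P x e /\ Q x e) _).
  by move=> e; split=> [[x []]|[x]]; exists x.
exact: definable_and.
Qed.

Lemma definable_term_var i : definable_term (fun e => e i).
Proof. by exists (FEq 0 i.+1), inl. Qed.

Lemma definable_term_cst a : definable_term (fun _ => a).
Proof. by exists (FEq 0 1), (fun i => if i is 0 then inl 0%N else inr a). Qed.

Lemma definable_subst (P : S -> env -> Prop) t :
  definable (fun e => P (e 0%N) (fun n => e n.+1)) -> definable_term t ->
  definable (fun e => P (t e) e).
Proof.
move=> DP Dt.
apply: definable_ext (definable_ex (P := fun x e => x = t e /\ P x e) _).
  by move=> e; split=> [[x [->]]|]; last exists (t e).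
exact: definable_and.
Qed.

Lemma definable_app1 (P : S -> Prop) t :
  definable (fun e => P (e 0%N)) -> definable_term t ->
  definable (fun e => P (t e)).
Proof. exact: (@definable_subst (fun x _ => P x)). Qed.

Lemma definable_weaken P : definable P -> definable (fun e => P (fun n => e n.+1)).
Proof. exact: (@definable_reindex P (fun n => inl n.+1)). Qed.

Lemma definable_term_weaken t :
  definable_term t -> definable_term (fun e => t (fun n => e n.+1)).
Proof.
rewrite /definable_term => Dt.
exact: (definable_reindex (fun n => if n is k.+1 then inl k.+2 else inl 0%N) Dt).
Qed.

Lemma definable_app2 (P : S -> S -> Prop) t u :
  definable (fun e => P (e 0%N) (e 1%N)) -> definable_term t ->
  definable_term u -> definable (fun e => P (t e) (u e)).
Proof.
move=> DP Dt Du; apply: (@definable_subst (fun x e => P x (u e))) => //.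
apply: (@definable_subst (fun y e => P (e 0%N) y)); last exact: definable_term_weaken.
exact: (definable_reindex (fun n => if n is 0 then inl 1%N else inl 0%N) DP).
Qed.

Lemma definable_mem t u :
  definable_term t -> definable_term u -> definable (fun e => t e ∈ u e).
Proof. by apply: definable_app2; exists (FMem 0 1), inl. Qed.

Lemma definable_eq t u :
  definable_term t -> definable_term u -> definable (fun e => t e = u e).
Proof. by apply: definable_app2; exists (FEq 0 1), inl. Qed.

Lemma definable_term_app1 (h : S -> S) t :
  definable_term (fun e => h (e 0%N)) -> definable_term t ->
  definable_term (fun e => h (t e)).
Proof.
move=> Dh Dt; rewrite /definable_term.
apply: (@definable_subst (fun y e => e 0%N = h y)); last exact: definable_term_weaken.
exact: (definable_reindex (fun n => if n is 0 then inl 1%N else inl 0%N) Dh).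
Qed.

Lemma definable_term_app2 (h : S -> S -> S) t u :
  definable_term (fun e => h (e 0%N) (e 1%N)) -> definable_term t ->
  definable_term u -> definable_term (fun e => h (t e) (u e)).
Proof.
move=> Dh Dt Du; rewrite /definable_term.
apply: (@definable_subst (fun y e => e 0%N = h y (u (fun n => e n.+1))));
  last exact: definable_term_weaken.
apply: (@definable_subst (fun y e => e 1%N = h (e 0%N) y)); last first.
  exact: (definable_term_weaken (definable_term_weaken Du)).
apply: (definable_reindex (fun n => nth (inl 0%N) [:: inl 2; inl 1; inl 0]%N n) Dh).
Qed.

Lemma definable_ite P t u :
  definable P -> definable_term t -> definable_term u ->
  definable_term (fun e => if `[< P e >] then t e else u e).
Proof.
move=> DP Dt Du.
apply: (@definable_ext (fun e => (P (fun n => e n.+1) /\ e 0%N = t (fun n => e n.+1))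
  \/ (~ P (fun n => e n.+1) /\ e 0%N = u (fun n => e n.+1)))).
  move=> e; case: asboolP => p; split; [by case=> -[]|by left|by case=> -[]|by right].
have DP' := definable_weaken DP.
by apply: definable_or; apply: definable_and => //; apply: definable_not.
Qed.

(* Unlike [xget], which picks a member of a set by choice, this is definable
   when P is. *)
Definition the (x0 : S) (P : S -> Prop) : S :=
  xget x0 [set y | P y /\ forall z, P z -> z = y].

Lemma the_eq x0 (P : S -> Prop) y :
  P y -> (forall z, P z -> z = y) -> the x0 P = y.
Proof.
move=> Py Pu; apply: xget_unique; first by [].
by move=> z [/Pu].
Qed.

Lemma definable_the t (P : S -> env -> Prop) :
  definable_term t -> definable (fun e => P (e 0%N) (fun n => e n.+1)) ->
  definable_term (fun e => the (t e) (P^~ e)).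
Proof.
move=> Dt DP.
pose U y e := P y e /\ forall z, P z e -> z = y.
have DU : definable (fun e => U (e 0%N) (fun n => e n.+1)).
  apply: definable_and => //; apply: definable_all.
  apply: definable_imp.
    exact: (definable_reindex (fun n => if n is k.+1 then inl k.+2 else inl 0%N) DP).
  by exists (FEq 0 1), inl.
apply: (@definable_ext (fun e => U (e 0%N) (fun n => e n.+1) \/
  ((forall y, ~ U y (fun n => e n.+1)) /\ e 0%N = t (fun n => e n.+1)))).
  move=> e; rewrite /the; case: xgetP => [y -> Uy|nU]; split.
  - by case=> [[h1 h2]|[/(_ _ Uy)//]]; apply: Uy.2.
  - by move=> ->; left.
  - by case=> [/nU|[]].
  - by right.
apply: definable_or => //; apply: definable_and => //.
apply: definable_all; apply: definable_not.
exact: (definable_reindex (fun n => if n is k.+1 then inl k.+2 else inl 0%N) DU).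
Qed.

End Definable.

(* Redefined below, as is [dfn_hook_sum], when more operations are available. *)
Ltac dfn_hook := fail.

Ltac dfn_step :=
  first
  [ assumption
  | lazymatch goal with
    | |- definable (fun _ => ?A) => apply: definable_prop
    | |- definable (fun e => elem (@?t e) (@?u e)) => apply: (definable_mem (t := t) (u := u))
    | |- definable (fun e => @eq _ (@?t e) (@?u e)) => apply: (definable_eq (t := t) (u := u))
    | |- definable (fun e => not (@?P e)) => apply: (definable_not (P := P))
    | |- definable (fun e => and (@?P e) (@?Q e)) => apply: (definable_and (P := P) (Q := Q))
    | |- definable (fun e => and3 _ _ _) => apply: definable_and3
    | |- definable (fun e => or (@?P e) (@?Q e)) => apply: (definable_or (P := P) (Q := Q))
    | |- definable (fun e => iff (@?P e) (@?Q e)) => apply: (definable_iff (P := P) (Q := Q))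
    | |- definable (fun e => ex2 _ _) => apply: definable_ex2
    | |- definable (fun e => ex _) => apply: definable_ex
    | |- definable (fun e => forall _, _) => first [apply: definable_imp | apply: definable_all]
    | |- definable_term (fun _ => ?a) => apply: definable_term_cst
    | |- definable_term (fun e => e ?i) => apply: definable_term_var
    | |- definable_term (fun e => if asbool _ then _ else _) => apply: definable_ite
    | |- definable_term (fun e => the _ _) => apply: definable_the
    end
  | dfn_hook
  | lazymatch goal with
    | H : definable (fun e => ?P (e 0%N) (e 1%N))
        |- definable (fun e => ?P _ _) => apply: (definable_app2 H)
    | H : definable (fun e => ?P (e 0%N))
        |- definable (fun e => ?P _) => apply: (definable_app1 H)
    | H : definable_term (fun e => ?f (e 0%N) (e 1%N))
        |- definable_term (fun e => ?f _ _) => apply: (definable_term_app2 H)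
    | H : definable_term (fun e => ?f (e 0%N))
        |- definable_term (fun e => ?f _) => apply: (definable_term_app1 H)
    end ].

Ltac dfn := repeat (cbv beta; dfn_step).

Lemma definable_is_empty (S : set_structure) (t : (nat -> S) -> S) :
  definable_term t -> definable (fun e => is_empty (t e)).
Proof.
by move=> Dt; apply: (definable_app1 (P := @is_empty S)) => //; rewrite /is_empty; dfn.
Qed.

Lemma definable_is_succ (S : set_structure) (t u : (nat -> S) -> S) :
  definable_term t -> definable_term u -> definable (fun e => is_succ (t e) (u e)).
Proof.
by move=> Dt Du; apply: (definable_app2 (P := @is_succ S)) => //; rewrite /is_succ; dfn.
Qed.

Ltac dfn_hook ::= lazymatch goal with
  | |- definable (fun e => is_empty _) => apply: definable_is_empty
  | |- definable (fun e => is_succ _ _) => apply: definable_is_succ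
  end.

Lemma definable_natural (S : set_structure) (t : (nat -> S) -> S) :
  definable_term t -> definable (fun e => natural (t e)).
Proof.
by move=> Dt; apply: (definable_app1 (P := @natural S)) => //;
  rewrite /natural /inductive_set; dfn.
Qed.

(** * Natural numbers in a model of Zermelo set theory *)

Section Zermelo.
Variables (S : set_structure) (Z : zermelo S).
Implicit Types (x y z w k n a : S) (e : nat -> S).

Lemma zermelo_ext x y : (forall z, z ∈ x <-> z ∈ y) -> x = y.
Proof. exact: z_extensionality. Qed.

Lemma zermelo_separation (P : S -> Prop) x :
  definable (fun e => P (e 0%N)) -> exists z, forall w, w ∈ z <-> w ∈ x /\ P w.
Proof.
move=> [f [r Pf]].
(* The schema has a single environment for all parameters: the one read at index [i] of [f] goes to
   its slot 2i+1, while the variables other than 0, on which [P] does not depend, receive [x]. *)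
pose r' i := match r i with inl 0 => 0%N | inl k.+1 => i.*2.+1 | inr _ => i.*2.+2 end.
have [z zP] := z_separation Z (rename r' f) (fun i => if odd i then
   match r i./2 with inr a => a | inl _ => x end else x) x.
exists z => w; rewrite zP sat_rename (Pf (fun i => if i is 0 then w else x)).
set e1 := (X in sat X f); suff -> : e1 = lookup (fun i => if i is 0 then w else x) \o r by [].
apply/funext => i; rewrite /e1 /= /r'.
case E : (r i) => [[|k]|a] //=; first by rewrite odd_double.
by rewrite odd_double /= uphalf_double E.
Qed.

Lemma zermelo_empty : exists z : S, is_empty z.
Proof. by have [w [_ [z [? _]]]] := z_infinity Z; exists z. Qed.

Lemma zermelo_succ x : exists y, is_succ y x.
Proof.
have [a aP] := z_pairing Z x x; have [b bP] := z_pairing Z x a.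
have [u uP] := z_union Z b.
exists u => w; rewrite uP; split.
  by move=> [y /bP[->|->]]; [left|move=> /aP[]; right].
by move=> [wx|->]; [exists x|exists a] => //; [apply/bP; left|apply/bP; right|apply/aP; left].
Qed.

Definition zero : S := sval (cid zermelo_empty).

Lemma zeroP : is_empty zero. Proof. exact: svalP. Qed.

Lemma is_empty_zero z : is_empty z -> z = zero.
Proof. by move=> ze; apply: zermelo_ext => w; split=> [/ze|/zeroP]. Qed.

Definition succ x : S := the zero (fun y => is_succ y x).

Lemma is_succ_uniq y y' x : is_succ y x -> is_succ y' x -> y = y'.
Proof. by move=> yx y'x; apply: zermelo_ext => z; rewrite yx y'x. Qed.

Lemma succP x : is_succ (succ x) x.
Proof.
have [y yx] := zermelo_succ x.
by rewrite /succ (@the_eq _ _ _ y) // => z zx; apply: is_succ_uniq zx yx.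
Qed.

Lemma is_succE y x : is_succ y x <-> y = succ x.
Proof.
by split=> [yx|->]; [exact: is_succ_uniq yx (succP x)|exact: succP].
Qed.

Lemma mem_succ w x : w ∈ succ x <-> w ∈ x \/ w = x.
Proof. exact: succP. Qed.

Lemma definable_succ (t : (nat -> S) -> S) :
  definable_term t -> definable_term (fun e => succ (t e)).
Proof.
by move=> Dt; apply: (definable_term_app1 (h := succ)) => //; rewrite /succ; dfn.
Qed.

Lemma mem_upair w x y : w ∈ upair x y <-> w = x \/ w = y.
Proof.
have [z zP] := z_pairing Z x y.
rewrite /upair; case: xgetP => [v _|/(_ z)]; first exact.
by case.
Qed.

Lemma upairE z x y : z = upair x y <-> forall w, w ∈ z <-> w = x \/ w = y.
Proof.
split=> [-> w|zP]; first exact: mem_upair.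
by apply: zermelo_ext => w; rewrite zP mem_upair.
Qed.

Lemma definable_upair (t u : (nat -> S) -> S) :
  definable_term t -> definable_term u ->
  definable_term (fun e => upair (t e) (u e)).
Proof.
move=> Dt Du; apply: (definable_term_app2 (h := @upair S)) => //.
rewrite /definable_term; apply: (@definable_ext _ (fun e =>
  forall w, w ∈ e 0%N <-> w = e 1%N \/ w = e 2%N)); last by dfn.
by move=> e; rewrite upairE.
Qed.

Lemma definable_opair (t u : (nat -> S) -> S) :
  definable_term t -> definable_term u ->
  definable_term (fun e => opair (t e) (u e)).
Proof. by move=> Dt Du; do !apply: definable_upair. Qed.

Lemma upair_inj x y y' : upair x y = upair x y' -> y = y'.
Proof.
move=> E; have : y ∈ upair x y' by rewrite -E mem_upair; right.
rewrite mem_upair => -[yx|//]; have : y' ∈ upair x y by rewrite E mem_upair; right.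
by rewrite mem_upair yx => -[->|->].
Qed.

Lemma opair_inj x y x' y' : opair x y = opair x' y' -> x = x' /\ y = y'.
Proof.
move=> E; suff xx' : x = x'.
  by split=> //; move: E; rewrite /opair xx' => /upair_inj /upair_inj.
have : upair x x ∈ opair x' y' by rewrite -E mem_upair; left.
rewrite mem_upair => -[] /esym /upairE /(_ x') [+ _] => /(_ _)[]; rewrite ?mem_upair //.
- by left.
- by left.
Qed.

Lemma zermelo_add a x : exists b, forall w, w ∈ b <-> w ∈ a \/ w = x.
Proof.
have [p pP] := z_pairing Z x x; have [q qP] := z_pairing Z a p.
have [u uP] := z_union Z q.
exists u => w; rewrite uP; split.
  by move=> [y /qP[->|->]]; [left|move=> /pP[]; right].
by move=> [wx|->]; [exists a|exists p] => //; [apply/qP; left|apply/qP; right|apply/pP; left].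
Qed.

Lemma natural_zero : natural zero.
Proof. by move=> w [w0 _]; apply: w0; exact: zeroP. Qed.

Lemma natural_succ n : natural n -> natural (succ n).
Proof. by move=> nn w wi; apply: (wi.2 n); [exact: nn|exact: succP]. Qed.

(** Since [natural] is a predicate and not a set, separation is applied to the set given by
    infinity; its part made of natural numbers satisfying [P] is inductive, hence contains [n]. *)
Lemma natural_ind (P : S -> Prop) :
  definable (fun e => P (e 0%N)) -> P zero ->
  (forall k, natural k -> P k -> P (succ k)) ->
  forall n, natural n -> P n.
Proof.
move=> DP P0 PS n nn.
have [w [wi _]] := z_infinity Z.
have DnP : definable (fun e => natural (e 0%N) /\ P (e 0%N)).
  by apply: definable_and => //; apply: definable_natural; dfn.
have [v vP] := @zermelo_separation (fun y => natural y /\ P y) w DnP.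
suff /nn /vP[_ []] : inductive_set v by [].
split=> [z /is_empty_zero ->|x y /vP[xw [nx Px]] /is_succE ->].
  by apply/vP; do !split=> //; [apply: wi.1; exact: zeroP|exact: natural_zero].
apply/vP; split; first by apply: (wi.2 x) => //; exact: succP.
by split; [exact: natural_succ|exact: PS].
Qed.

Lemma mem_natural n k : natural n -> k ∈ n -> natural k.
Proof.
move=> nn; move: n nn k; apply: natural_ind; last 2 first.
- by move=> k /zeroP.
- by move=> m mm IH k /mem_succ[/IH//|->].
by dfn; apply: definable_natural; dfn.
Qed.

Lemma natural_trans n k m : natural n -> k ∈ n -> m ∈ k -> m ∈ n.
Proof.
move=> nn; move: n nn k m; apply: natural_ind; first by dfn.
  by move=> k m /zeroP.
move=> n nn IH k m /mem_succ[kn mk|-> mn]; apply/mem_succ; left => //.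
exact: IH mk.
Qed.

(** With no axiom of foundation, this comes from induction. It makes [succ] injective and keeps a
    new last index apart from the earlier ones. *)
Lemma natural_irrefl n : natural n -> ~ n ∈ n.
Proof.
move: n; apply: natural_ind; [by dfn|exact: zeroP|move=> n nn IH].
move=> /mem_succ[Sn|E]; last by apply: IH; rewrite -{2}E; apply/mem_succ; right.
by apply: IH; apply: (natural_trans nn Sn); apply/mem_succ; right.
Qed.

Lemma succ_inj n m : natural n -> natural m -> succ n = succ m -> n = m.
Proof.
move=> nn nm E.
have : n ∈ succ m by rewrite -E; apply/mem_succ; right.
have : m ∈ succ n by rewrite E; apply/mem_succ; right.
move=> /mem_succ[mn|//] /mem_succ[nm'|//].
by case: (natural_irrefl nn); apply: natural_trans nm'.
Qed.

Lemma succ_neq0 n : succ n <> zero.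
Proof. by move=> E; apply: (@zeroP n); rewrite -E; apply/mem_succ; right. Qed.

Lemma mem_succ_succ n k : natural n -> succ k ∈ succ n -> k ∈ n.
Proof.
move=> nn /mem_succ[kn|<-]; last by apply/mem_succ; right.
by apply: (natural_trans nn kn); apply/mem_succ; right.
Qed.

(** A total and definable reading of a set of pairs as a function; the default [a] occurs only where
    no unique value exists. *)
Definition app a x : S := the a (fun y => opair x y ∈ a).

Lemma definable_app (t u : (nat -> S) -> S) :
  definable_term t -> definable_term u ->
  definable_term (fun e => app (t e) (u e)).
Proof.
move=> Dt Du; apply: (definable_term_app2 (h := app)) => //; rewrite /app.
apply: definable_the; first by dfn.
by apply: definable_mem; [apply: definable_opair|]; dfn.
Qed.

(** Induction on [n], adjoining one pair at each step, takes the place of replacement. *)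
Lemma exists_graph (h : S -> S) n :
  definable_term (fun e => h (e 0%N)) -> natural n ->
  exists a, forall z, z ∈ a <-> exists2 k, k ∈ n & z = opair k (h k).
Proof.
move=> Dh; move: n; apply: natural_ind.
- by repeat (dfn; apply: definable_opair); dfn.
- by exists zero => z; split=> [/zeroP//|[k /zeroP]].
move=> n nn [a aP]; have [b bP] := zermelo_add a (opair n (h n)).
exists b => z; rewrite bP aP; split.
  move=> [[k kn ->]|->]; [exists k|exists n] => //; apply/mem_succ; first by left.
  by right.
by move=> [k /mem_succ[kn|->] ->]; [left; exists k|right].
Qed.

Lemma app_graph (h : S -> S) (B : S -> Prop) a k :
  (forall z, z ∈ a <-> exists2 k, B k & z = opair k (h k)) -> B k ->
  app a k = h k.
Proof.
move=> aP kB; apply: the_eq; first by apply/aP; exists k.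
by move=> z /aP[k' _ /opair_inj[-> ->]].
Qed.

End Zermelo.

(** * Transfer *)

Section Transfer.
Variables (S S' : set_structure) (j : S -> S').

(** Parameters are excluded here, unlike in [definable]: one and the same formula has to make sense
    in both structures. *)
Definition same_formula (P : (nat -> S) -> Prop) (P' : (nat -> S') -> Prop) :=
  exists f, (forall e, P e <-> sat e f) /\ (forall e, P' e <-> sat e f).

Lemma same_formula_ext P P' Q Q' :
  (forall e, P e <-> Q e) -> (forall e, P' e <-> Q' e) ->
  same_formula P P' -> same_formula Q Q'.
Proof.
by move=> PQ PQ' [f [Pf P'f]]; exists f; split=> e; rewrite -?PQ -?PQ' ?Pf ?P'f.
Qed.

Lemma same_formula_sat f r : same_formula
  (fun e => sat (fun n => e (r n)) f) (fun e => sat (fun n => e (r n)) f).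
Proof. by exists (rename r f); split=> e; rewrite sat_rename. Qed.

Lemma same_formula_mem i k :
  same_formula (fun e => e i ∈ e k) (fun e => e i ∈ e k).
Proof. by exists (FMem i k). Qed.

Lemma same_formula_eq i k :
  same_formula (fun e => e i = e k) (fun e => e i = e k).
Proof. by exists (FEq i k). Qed.

Lemma same_formula_not P P' :
  same_formula P P' -> same_formula (fun e => ~ P e) (fun e => ~ P' e).
Proof. by move=> [f [Pf P'f]]; exists (FNot f); split=> e /=; rewrite ?Pf ?P'f. Qed.

Lemma same_formula_and P P' Q Q' :
  same_formula P P' -> same_formula Q Q' ->
  same_formula (fun e => P e /\ Q e) (fun e => P' e /\ Q' e).
Proof.
move=> [f [Pf P'f]] [g [Qg Q'g]].
by exists (FAnd f g); split=> e /=; rewrite ?Pf ?P'f ?Qg ?Q'g.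
Qed.

Lemma same_formula_ex (P : S -> (nat -> S) -> Prop) (P' : S' -> (nat -> S') -> Prop) :
  same_formula (fun e => P (e 0%N) (fun n => e n.+1))
               (fun e => P' (e 0%N) (fun n => e n.+1)) ->
  same_formula (fun e => exists x, P x e) (fun e => exists x, P' x e).
Proof.
move=> [f [Pf P'f]]; exists (FEx f); split=> e /=.
  by split=> -[x xP]; exists x; have := Pf (scons x e) => /= Pfx; apply/Pfx.
by split=> -[x xP]; exists x; have := P'f (scons x e) => /= Pfx; apply/Pfx.
Qed.

Lemma same_formula_or P P' Q Q' :
  same_formula P P' -> same_formula Q Q' ->
  same_formula (fun e => P e \/ Q e) (fun e => P' e \/ Q' e).
Proof.
move=> /same_formula_not DP /same_formula_not DQ.
apply: same_formula_ext (same_formula_not (same_formula_and DP DQ)) => e.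
  by split=> [/not_andP[/contrapT|/contrapT]|[p|q] []]; [left|right| |].
by split=> [/not_andP[/contrapT|/contrapT]|[p|q] []]; [left|right| |].
Qed.

Lemma same_formula_imp P P' Q Q' :
  same_formula P P' -> same_formula Q Q' ->
  same_formula (fun e => P e -> Q e) (fun e => P' e -> Q' e).
Proof.
move=> /same_formula_not DP DQ.
apply: same_formula_ext (same_formula_or DP DQ) => e.
  by split=> [[//|q _ //]|PQ]; have [p|] := pselect (P e); [right; apply: PQ|left].
by split=> [[//|q _ //]|PQ]; have [p|] := pselect (P' e); [right; apply: PQ|left].
Qed.

Lemma same_formula_iff P P' Q Q' :
  same_formula P P' -> same_formula Q Q' ->
  same_formula (fun e => P e <-> Q e) (fun e => P' e <-> Q' e).
Proof. by move=> DP DQ; apply: same_formula_and; apply: same_formula_imp. Qed.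

Lemma same_formula_all (P : S -> (nat -> S) -> Prop) (P' : S' -> (nat -> S') -> Prop) :
  same_formula (fun e => P (e 0%N) (fun n => e n.+1))
               (fun e => P' (e 0%N) (fun n => e n.+1)) ->
  same_formula (fun e => forall x, P x e) (fun e => forall x, P' x e).
Proof.
move=> /same_formula_not
  /(@same_formula_ex (fun x e => ~ P x e) (fun x e => ~ P' x e)) /same_formula_not.
by apply: same_formula_ext => e;
  (split=> [/forallNP H x|H [x]]; [exact: contrapT (H x)|exact]).
Qed.

Lemma same_formula_ex2 (P Q : S -> (nat -> S) -> Prop)
    (P' Q' : S' -> (nat -> S') -> Prop) :
  same_formula (fun e => P (e 0%N) (fun n => e n.+1))
               (fun e => P' (e 0%N) (fun n => e n.+1)) ->
  same_formula (fun e => Q (e 0%N) (fun n => e n.+1))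
               (fun e => Q' (e 0%N) (fun n => e n.+1)) ->
  same_formula (fun e => exists2 x, P x e & Q x e)
               (fun e => exists2 x, P' x e & Q' x e).
Proof.
move=> DP DQ.
apply: (@same_formula_ext (fun e => exists x, P x e /\ Q x e)
                          (fun e => exists x, P' x e /\ Q' x e)).
- by move=> e; split=> [[x []]|[x]]; exists x.
- by move=> e; split=> [[x []]|[x]]; exists x.
apply: (@same_formula_ex (fun x e => P x e /\ Q x e) (fun x e => P' x e /\ Q' x e)).
exact: same_formula_and.
Qed.

(** Only an upper bound on the free indices: nothing is subtracted under a quantifier. *)
Fixpoint free_bound (f : formula) : nat :=
  match f with
  | FMem i k | FEq i k => (maxn i k).+1
  | FNot g | FEx g => free_bound g
  | FAnd g h => maxn (free_bound g) (free_bound h)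
  end.

Lemma eq_sat (T : set_structure) f (e e' : nat -> T) :
  (forall i, (i < free_bound f)%N -> e i = e' i) -> sat e f <-> sat e' f.
Proof.
elim: f e e' => [i k|i k|g IH|g IHg h IHh|g IH] e e' /= ee'.
- by rewrite !ee' // ltnS leq_max leqnn ?orbT.
- by rewrite !ee' // ltnS leq_max leqnn ?orbT.
- by rewrite (IH _ _ ee').
- by rewrite (IHg e e') ?(IHh e e') // => i ilt; apply: ee'; rewrite leq_max ilt ?orbT.
- suff H x : sat (scons x e) g <-> sat (scons x e') g by split=> -[x /H ?]; exists x.
  by apply: IH => -[|i] //= ilt; apply: ee'; exact: ltnW.
Qed.

Definition FAll f := FNot (FEx (FNot f)).

Lemma sat_FAll (T : set_structure) (e : nat -> T) f :
  sat e (FAll f) <-> forall x, sat (scons x e) f.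
Proof.
by split=> /= [/forallNP H x|H [x]]; [exact: contrapT (H x)|exact].
Qed.

Lemma sat_closure (T : set_structure) N f (e h : nat -> T) :
  sat e (iter N FAll f) -> sat (fun i => if (i < N)%N then h i else e (i - N)%N) f.
Proof.
elim: N e => [|N IH] e; first by congr (sat _ f); apply/funext => i; rewrite subn0.
rewrite iterS sat_FAll => /(_ (h N)) /IH; congr (sat _ f); apply/funext => i.
rewrite ltnS; case: ltngtP => [//| |->]; last by rewrite subnn.
by rewrite subnS -subn_gt0; case: (i - N)%N.
Qed.

Hypothesis (jP : elementary j).

Lemma transfer (P : (nat -> S) -> Prop) (P' : (nat -> S') -> Prop) e :
  same_formula P P' -> P e <-> P' (j \o e).
Proof. by move=> [f [Pf P'f]]; rewrite Pf P'f; exact: jP. Qed.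

(** Elementarity only concerns environments in the image of [j]. The universal closure has no free
    variables, so its transfer reaches every environment of [S']. *)
Lemma transfer_valid (P : (nat -> S) -> Prop) (P' : (nat -> S') -> Prop) :
  S -> same_formula P P' -> (forall e, P e) -> forall e, P' e.
Proof.
move=> x0 [f [Pf P'f]] VP e; rewrite P'f.
have : sat (fun _ : nat => x0) (iter (free_bound f) FAll f).
  have : forall e : nat -> S, sat e f by move=> e'; apply/Pf.
  elim: (free_bound f) (fun _ => x0) => [|N IH] e0 V; first exact: V.
  by rewrite iterS sat_FAll => x; exact: IH.
move=> /jP /(sat_closure e); apply: (iffLR (eq_sat _)) => i /= ilt.
by rewrite ilt.
Qed.

End Transfer.

Ltac sf := repeat (cbv beta; lazymatch goal with
  | |- same_formula (fun e => elem _ _) _ => apply: same_formula_mem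
  | |- same_formula (fun e => @eq _ _ _) _ => apply: same_formula_eq
  | |- same_formula (fun e => not _) _ => apply: same_formula_not
  | |- same_formula (fun e => and _ _) _ => apply: same_formula_and
  | |- same_formula (fun e => or _ _) _ => apply: same_formula_or
  | |- same_formula (fun e => iff _ _) _ => apply: same_formula_iff
  | |- same_formula (fun e => ex2 _ _) _ => apply: same_formula_ex2
  | |- same_formula (fun e => ex _) _ => apply: same_formula_ex
  | |- same_formula (fun e => forall _, _) _ =>
      first [apply: same_formula_imp | apply: same_formula_all]
  end).

(** * Transfer of the axioms and of ordered pairs *)

Section ZermeloTransfer.
Variables (S S' : set_structure) (j : S -> S') (jP : elementary j).
Variable (Z : zermelo S).

Lemma zermelo_transfer : zermelo S'.
Proof.
have [z0 _] := cid (zermelo_empty Z).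
split.
- move=> x y.
  apply: (transfer_valid jP (P := fun e => (forall z, z ∈ e 0%N <-> z ∈ e 1%N) -> e 0%N = e 1%N)
    (P' := fun e => (forall z, z ∈ e 0%N <-> z ∈ e 1%N) -> e 0%N = e 1%N)
    z0 _ _ (scons x (fun _ => y))).
    by sf.
  by move=> e; exact: z_extensionality.
- move=> x y.
  apply: (transfer_valid jP (P := fun e => exists z, forall w, w ∈ z <-> w = e 0%N \/ w = e 1%N)
    (P' := fun e => exists z, forall w, w ∈ z <-> w = e 0%N \/ w = e 1%N)
    z0 _ _ (scons x (fun _ => y))).
    by sf.
  by move=> e; exact: z_pairing.
- move=> x.
  apply: (transfer_valid jP
    (P := fun e => exists z, forall w, w ∈ z <-> exists2 y, y ∈ e 0%N & w ∈ y)
    (P' := fun e => exists z, forall w, w ∈ z <-> exists2 y, y ∈ e 0%N & w ∈ y)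
    z0 _ _ (fun _ => x)).
    by sf.
  by move=> e; exact: z_union.
- move=> x.
  apply: (transfer_valid jP
    (P := fun e => exists z, forall w, w ∈ z <-> forall v, v ∈ w -> v ∈ e 0%N)
    (P' := fun e => exists z, forall w, w ∈ z <-> forall v, v ∈ w -> v ∈ e 0%N)
    z0 _ _ (fun _ => x)).
    by sf.
  by move=> e; exact: z_powerset.
- apply: (transfer_valid jP
    (P := fun _ => exists w : S, inductive_set w /\ exists z, is_empty z /\ z ∈ w)
    (P' := fun _ => exists w : S', inductive_set w /\ exists z, is_empty z /\ z ∈ w)
    z0 _ _ (fun _ => j z0)).
    by rewrite /inductive_set /is_empty /is_succ; sf.
  by move=> e; exact: z_infinity.
(* The schema is transferred instance by instance: [f] is fixed, while [x] and the parameters are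
   free variables of a valid formula. *)
- move=> f e x.
  have := transfer_valid jP
    (P := fun e => exists z, forall w, w ∈ z <-> w ∈ e 0%N /\ sat (scons w (fun n => e n.+1)) f)
    (P' := fun e => exists z, forall w, w ∈ z <-> w ∈ e 0%N /\ sat (scons w (fun n => e n.+1)) f)
    z0 _ _ (scons x e).
  apply; last by move=> e'; exact: z_separation.
  apply: same_formula_ex; apply: same_formula_all; apply: same_formula_iff; first by sf.
  apply: same_formula_and; first by sf.
  by apply: same_formula_ext (same_formula_sat S S' f (fun n => if n is k.+1 then k.+3 else 0%N)) => e';
    (suff -> : (fun n => e' (if n is k.+1 then k.+3 else 0%N)) =
       scons (e' 0%N) (fun n => e' n.+3) by []); apply/funext => -[].
Qed.

(** The choice hidden in [opair] is not first-order; in a model of pairing it can be replaced by the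
    explicit description [O], and both structures are such models. *)
Lemma same_formula_opair i k :
  same_formula (fun e : nat -> S => e 0%N = opair (e i) (e k))
    (fun e : nat -> S' => e 0%N = opair (e i) (e k)).
Proof.
pose U (T : set_structure) (z x y : T) := forall w, w ∈ z <-> w = x \/ w = y.
pose O (T : set_structure) (z x y : T) := exists a, U T a x x /\ exists b, U T b x y /\ U T z a b.
suff H (T : set_structure) (ZT : zermelo T) (z x y : T) : O T z x y <-> z = opair x y.
  apply: (@same_formula_ext _ _ (fun e => O _ (e 0%N) (e i) (e k))
     (fun e => O _ (e 0%N) (e i) (e k))); last by rewrite /O /U; sf.
  - by move=> e; exact: H.
  - by move=> e; apply: H; exact: zermelo_transfer.
rewrite /O /U; split=> [[a [/(upairE ZT) -> [b [/(upairE ZT) ->]]]]|->].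
  by move=> /(upairE ZT).
exists (upair x x); split; first exact/(upairE ZT).
exists (upair x y); split; first exact/(upairE ZT).
exact/(upairE ZT).
Qed.

Lemma same_formula_opair_mem i k m :
  same_formula (fun e : nat -> S => opair (e i) (e k) ∈ e m)
    (fun e : nat -> S' => opair (e i) (e k) ∈ e m).
Proof.
apply: (@same_formula_ext _ _ (fun e : nat -> S => exists z, z = opair (e i) (e k) /\ z ∈ e m)
     (fun e : nat -> S' => exists z, z = opair (e i) (e k) /\ z ∈ e m)).
- by move=> e; split=> [[z [->]]|]; last exists (opair (e i) (e k)).
- by move=> e; split=> [[z [->]]|]; last exists (opair (e i) (e k)).
apply: same_formula_ex; apply: same_formula_and; last by sf.
exact: same_formula_opair.
Qed.

End ZermeloTransfer.

(** * The star of a uniform space: infinitesimal entourages and chains *)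

Section StarUniformity.
Variables (F : nonstandard_framework) (X : uniformType).
Variable (cX : uniform_in (standard F) X).
Local Notation Z := (standard_zermelo F).
Local Notation starP := (@star_elementary F).

Lemma internal_zermelo : zermelo (internal F).
Proof. exact: (zermelo_transfer starP Z). Qed.

Lemma star_mem (x y : standard F) : x ∈ y <-> star x ∈ star y.
Proof.
exact: (transfer starP (scons x (fun _ => y)) (same_formula_mem _ _ 0 1)).
Qed.

Lemma star_subset (x y : standard F) :
  (forall z, z ∈ x -> z ∈ y) -> forall z, z ∈ star x -> z ∈ star y.
Proof.
apply: (iffLR (transfer starP (scons x (fun _ => y))
  (P := fun e => forall z, z ∈ e 0%N -> z ∈ e 1%N)
  (P' := fun e => forall z, z ∈ e 0%N -> z ∈ e 1%N) _)).
by sf.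
Qed.

Lemma star_inverse (x y : standard F) :
  (forall a b, opair a b ∈ x -> opair b a ∈ y) ->
  forall a b, opair a b ∈ star x -> opair b a ∈ star y.
Proof.
apply: (iffLR (transfer starP (scons x (fun _ => y))
  (P := fun e => forall a b, opair a b ∈ e 0%N -> opair b a ∈ e 1%N)
  (P' := fun e => forall a b, opair a b ∈ e 0%N -> opair b a ∈ e 1%N) _)).
by sf; apply: (same_formula_opair_mem starP Z).
Qed.

Lemma mem_ent (E : set (X * X)) (a b : X) :
  entourage E -> opair (pt cX a) (pt cX b) ∈ ent cX E <-> E (a, b).
Proof.
move=> entE; rewrite (entP cX entE); split; last by exists (a, b).
by move=> [[c d] Ecd] /(opair_inj Z)[/(@pt_inj _ _ cX) -> /(@pt_inj _ _ cX) ->].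
Qed.

Lemma star_diag (E : set (X * X)) : entourage E ->
  forall x, x ∈ star (Defs.space cX) -> opair x x ∈ star (ent cX E).
Proof.
move=> entE.
apply: (iffLR (transfer starP (scons (Defs.space cX) (fun _ => ent cX E))
  (P := fun e => forall z, z ∈ e 0%N -> opair z z ∈ e 1%N)
  (P' := fun e => forall z, z ∈ e 0%N -> opair z z ∈ e 1%N) _)).
  by sf; apply: (same_formula_opair_mem starP Z).
move=> z /(spaceP cX)[x _ ->]; apply/mem_ent => //; exact: entourage_refl.
Qed.

Lemma star_ent_inv (E : set (X * X)) (a b : internal F) : entourage E ->
  opair a b ∈ star (ent cX (E^-1)%relation) -> opair b a ∈ star (ent cX E).
Proof.
move=> entE; move: a b; apply: star_inverse => a b.
have entV := entourage_inv entE.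
move=> /(entP cX entV)[[x y] Vxy] /(opair_inj Z)[-> ->] /=.
exact/mem_ent.
Qed.

Lemma finite_entourage (T : Type) (p : set T) (E : T -> set (X * X)) :
  finite_set p -> (forall q, p q -> entourage (E q)) ->
  exists2 E0, entourage E0 & forall q, p q -> E0 `<=` E q.
Proof.
move=> /(finite_seqP (T := {classic T}))[s ->] {p}.
elim: s => [|q s IH] entE; first by exists setT; [exact: entourageT|].
have [|E0 entE0 E0s] := IH; first by move=> r rs; apply: entE; rewrite /= inE rs orbT.
exists (E0 `&` E q); first by apply: filterI => //; apply: entE; rewrite /= inE eqxx.
move=> r /=; rewrite inE => /predU1P[->|rs]; first exact: subIsetr.
by apply: subset_trans (E0s _ rs); exact: subIsetl.
Qed.

Lemma exists_infinitesimal_entourage : exists2 W,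
  W ∈ star (uniformity cX) &
  forall E, entourage E -> forall w, w ∈ W -> w ∈ star (ent cX E).
Proof.
(* The unknown has index 0, the star of an entourage 1 and the star of the uniformity 2; under the
   quantifier the first two become 1 and 2. *)
pose phi := FAnd (FMem 0 2) (FNot (FEx (FAnd (FMem 0 1) (FNot (FMem 0 2))))).
pose par (E : set (X * X)) : nat -> internal F :=
  scons (star (ent cX E)) (fun _ => star (uniformity cX)).
have phiP W E : sat (scons W (par E)) phi <->
    W ∈ star (uniformity cX) /\ forall w, w ∈ W -> w ∈ star (ent cX E).
  split=> -[WU /= WE]; split=> //=; last by move=> [w [wW]] /(_ (WE _ wW)).
  by move=> w wW; apply: contrapT => wE; apply: WE; exists w.
pose p : set (formula * (nat -> internal F)) :=
  [set q | exists2 E, entourage E & q = (phi, par E)].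
have [|q [E _ ->] [|n]|p0 p0p fin|W Wp] := @internal_saturated F (range (@star F)) p.
(* All parameters are stars of standard elements, which is where the cardinality allowed by
   saturation is met. *)
- exact: card_image_le.
- by exists (ent cX E).
- by exists (uniformity cX).
- pose Eq q := xget setT [set E | entourage E /\ q = (phi, par E)].
  have EqP q : p0 q -> entourage (Eq q) /\ q = (phi, par (Eq q)).
    move=> /p0p[E entE qE]; rewrite /Eq.
    by case: xgetP => [? _ //|/(_ E)[]].
  have [E0 entE0 E0P] := finite_entourage fin (fun q qp => (EqP q qp).1).
  (* Finitely many conditions have a standard witness, the star of an entourage contained in all
     those involved. *)
  exists (star (ent cX E0)) => q qp; have [entq ->] := EqP q qp.
  apply/phiP; split.
    by apply/star_mem/(uniformityP cX); exists E0.
  apply: star_subset => z /(entP cX entE0)[xy E0xy ->].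
  by apply/(entP cX entq); exists xy => //; apply: E0P E0xy.
have W1 E : entourage E -> _ := fun entE => iffLR (phiP W E) (Wp _ (ex_intro2 _ _ E entE erefl)).
by exists W => [|E /W1[]//]; case: (W1 _ entourageT).
Qed.

(** Expressing connectedness through sets closed under steps avoids coding finite sequences by
    formulas. [W] and [A] are quantified inside the transferred statement, so they may be any
    internal sets, whereas the proof in the standard universe is an ordinary induction on the length
    of a chain. *)
Lemma star_chain (W A x : internal F) : chain_connected X ->
  W ∈ star (uniformity cX) ->
  (forall y z, y ∈ A -> z ∈ star (Defs.space cX) -> opair y z ∈ W -> z ∈ A) ->
  x ∈ A -> x ∈ star (Defs.space cX) -> forall z, z ∈ star (Defs.space cX) -> z ∈ A.
Proof.
move=> XC.
have := transfer starP (scons (uniformity cX) (fun _ => Defs.space cX))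
  (P := fun e => forall W A x, W ∈ e 0%N ->
    (forall y z, y ∈ A -> z ∈ e 1%N -> opair y z ∈ W -> z ∈ A) ->
    x ∈ A -> x ∈ e 1%N -> forall z, z ∈ e 1%N -> z ∈ A)
  (P' := fun e => forall W A x, W ∈ e 0%N ->
    (forall y z, y ∈ A -> z ∈ e 1%N -> opair y z ∈ W -> z ∈ A) ->
    x ∈ A -> x ∈ e 1%N -> forall z, z ∈ e 1%N -> z ∈ A).
move=> /(_ _)/(iffLR)/= H; apply: H; first by sf; apply: (same_formula_opair_mem starP Z).
move=> {}W {}A {}x /(uniformityP cX)[E entE ->] clA xA /(spaceP cX)[a _ xa].
move=> z /(spaceP cX)[b _ ->]; have [n [s [s0 <- sE]]] := XC E entE a b.
elim: n sE => [_|n IH sE]; first by rewrite s0 -xa.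
apply: (clA (pt cX (s n))).
- by apply: IH => i ilt; apply: sE; exact: ltnW.
- by apply/(spaceP cX); exists (s n.+1).
- by apply/mem_ent => //; exact: sE.
Qed.

End StarUniformity.

(** * Hyperfinite sums *)

Lemma definable_term_subst (S : set_structure) (h : S -> (nat -> S) -> S) t :
  definable_term (fun e => h (e 0%N) (fun n => e n.+1)) -> definable_term t ->
  definable_term (fun e => h (t e) e).
Proof.
move=> Dh Dt; rewrite /definable_term.
apply: (@definable_subst _ (fun x e => e 0%N = h x (fun n => e n.+1)));
  last exact: definable_term_weaken.
apply: (@definable_reindex _ (fun e => e 0%N = h (e 1%N) (fun n => e n.+2))
  (fun n => match n with 0 => inl 1 | 1 => inl 0 | _ => inl n end)%N Dh).
Qed.

(** The number [k] counts the binders crossed since the environment of [h] was fixed. *)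
Lemma definable_family (S : set_structure) k (h : S -> (nat -> S) -> S) t :
  definable_term (fun e => h (e 0%N) (fun n => e n.+1)) -> definable_term t ->
  definable_term (fun e => h (t e) (fun n => e (k + n)%N)).
Proof.
move=> Dh; apply: (@definable_term_subst _ (fun x e => h x (fun n => e (k + n)%N))).
exact: (@definable_reindex _ (fun e => e 0%N = h (e 1%N) (fun n => e n.+2))
  (fun n => match n with 0 => inl 0 | 1 => inl 1 | n.+2 => inl (k + n).+2 end)%N Dh).
Qed.

(** * Definability of the group operations *)

Section InternalGroup.
Variables (S : set_structure) (Z : zermelo S).
Variables (G : zmodType) (cG : abelian_group_in S G).
Local Notation gpt := (gpt cG).

Lemma gpt_set g : gpt g ∈ gset cG.
Proof. by apply/(gsetP cG); exists g. Qed.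

Definition gval (y : S) : G := xget 0 [set g | gpt g = y].

Lemma gptK : cancel gpt gval.
Proof.
move=> g; rewrite /gval; case: xgetP => [h _ /gpt_inj //|/(_ g)].
by case.
Qed.

Lemma gpt_gval y : gpt (gval y) = if `[< y ∈ gset cG >] then y else gpt 0.
Proof.
rewrite /gval; case: xgetP => [h _ <-|ny].
  by case: asboolP => // -[]; exact: gpt_set.
by case: asboolP => // /(gsetP cG)[g _ /esym /ny].
Qed.

Lemma definable_gval (t : (nat -> S) -> S) :
  definable_term t -> definable_term (fun e => gpt (gval (t e))).
Proof.
move=> Dt.
have -> : (fun e => gpt (gval (t e))) =
    (fun e => if `[< t e ∈ gset cG >] then t e else gpt 0).
  by apply/funext => e; rewrite gpt_gval.
by dfn.
Qed.

Lemma definable_geq (f g : (nat -> S) -> G) :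
  definable_term (fun e => gpt (f e)) -> definable_term (fun e => gpt (g e)) ->
  definable (fun e => f e = g e).
Proof.
move=> Df Dg; apply: definable_ext (definable_eq Df Dg) => e.
by split=> [/gpt_inj|->].
Qed.

Lemma definable_gadd (f g : (nat -> S) -> G) :
  definable_term (fun e => gpt (f e)) -> definable_term (fun e => gpt (g e)) ->
  definable_term (fun e => gpt (f e + g e)).
Proof.
have [a aP] := gadd cG; move=> Df Dg.
apply: (@definable_ext _ (fun e => opair (opair (gpt (f (fun n => e n.+1)))
    (gpt (g (fun n => e n.+1)))) (e 0%N) ∈ a)).
  move=> e; rewrite aP; split.
    move=> [[x y] _] /(opair_inj Z)[/(opair_inj Z)[/gpt_inj -> /gpt_inj ->]].
    by [].
  by move=> ->; exists (f (fun n => e n.+1), g (fun n => e n.+1)).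
have Dfg := definable_opair Z (definable_term_weaken Df) (definable_term_weaken Dg).
exact: (definable_mem (definable_opair Z Dfg (definable_term_var S 0))
  (definable_term_cst a)).
Qed.

(** Only addition is given as an internal map; the opposite is defined as the solution of an
    equation. *)
Lemma definable_gopp (f : (nat -> S) -> G) :
  definable_term (fun e => gpt (f e)) -> definable_term (fun e => gpt (- f e)).
Proof.
move=> Df; apply: (@definable_ext _ (fun e => e 0%N ∈ gset cG /\
  gval (e 0%N) + f (fun n => e n.+1) = 0)).
  move=> e; split=> [[/(gsetP cG)[g _ ->]]|->]; rewrite gptK.
    by move=> /eqP; rewrite addr_eq0 => /eqP ->.
  by rewrite addNr; split=> //; exact: gpt_set.
apply: definable_and; first by dfn.
apply: definable_geq; last by dfn.
apply: definable_gadd; first by apply: definable_gval; dfn.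
exact: (definable_term_weaken Df).
Qed.

Lemma definable_gite (P : (nat -> S) -> Prop) (f g : (nat -> S) -> G) :
  definable P -> definable_term (fun e => gpt (f e)) ->
  definable_term (fun e => gpt (g e)) ->
  definable_term (fun e => gpt (if `[< P e >] then f e else g e)).
Proof.
move=> DP Df Dg.
have -> : (fun e => gpt (if `[< P e >] then f e else g e)) =
  (fun e => if `[< P e >] then gpt (f e) else gpt (g e)).
  by apply/funext => e; case: ifP.
exact: definable_ite.
Qed.

End InternalGroup.

Ltac dfn_hook_sum := fail.

Ltac dfn_hook ::= first [dfn_hook_sum | lazymatch goal with
  | |- definable (fun e => is_empty _) => apply: definable_is_empty
  | |- definable (fun e => is_succ _ _) => apply: definable_is_succ
  | |- definable (fun e => natural _) => apply: definable_natural
  | |- definable_term (fun e => succ _ _) => apply: definable_succ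
  | |- definable_term (fun e => opair _ _) => apply: definable_opair; [assumption| |]
  | |- definable_term (fun e => app _ _) => apply: definable_app; [assumption| |]
  | cG : abelian_group_in _ _ |- definable (fun e => @eq _ _ _) =>
      apply: (definable_geq (cG := cG))
  | |- definable_term (fun e => gpt _ (gval _ _)) => apply: definable_gval
  | |- definable_term (fun e => gpt _ (_ + _)) => apply: definable_gadd; [assumption| |]
  | |- definable_term (fun e => gpt _ (- _)) => apply: definable_gopp; [assumption|]
  | |- definable_term (fun e => gpt _ (if asbool _ then _ else _)) => apply: definable_gite
  | H : definable_term (fun e => gpt _ (?f (e 0%N) (e 1%N)))
        |- definable_term (fun e => gpt _ (?f _ _)) =>
      apply: (@definable_term_app2 _ (fun x y => gpt _ (f x y)) _ _ H)
  | H : definable_term (fun e => gpt _ (?f (e 0%N)))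
        |- definable_term (fun e => gpt _ (?f _)) =>
      apply: (@definable_term_app1 _ (fun x => gpt _ (f x)) _ H)
  end].

Section Sums.
Variables (S : set_structure) (Z : zermelo S).
Variables (G : zmodType) (cG : abelian_group_in S G).
Local Notation gpt := (gpt cG).
Local Notation zero := (zero Z).
Local Notation succ := (succ Z).
Implicit Types (h : S -> G).

(* A trace need not be functional; that [sum_graph h n] is a function of n is
   proved by induction. *)
Definition sum_trace h (u : S) : Prop :=
  forall k z, opair k z ∈ u -> (k = zero /\ z = gpt 0) \/
    exists k' z', natural k' /\ k = succ k' /\ opair k' z' ∈ u /\
      z = gpt (gval cG z' + h k').

Definition sum_graph h n z := exists u, sum_trace h u /\ opair n z ∈ u.

Lemma definable_sum_graph (h : S -> (nat -> S) -> G) t v :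
  definable_term (fun e => gpt (h (e 0%N) (fun n => e n.+1))) ->
  definable_term t -> definable_term v ->
  definable (fun e => sum_graph (h^~ e) (t e) (v e)).
Proof.
move=> Dh Dt Dv; rewrite /sum_graph.
have Dw (r : (nat -> S) -> S) : definable_term r -> definable_term (fun e => r (fun n => e n.+1)).
  exact: definable_term_weaken.
apply: definable_ex; apply: definable_and.
  rewrite /sum_trace; dfn.
  (* Five binders have been crossed: the trace, [k], [z], [k'] and [z']; slot 1 holds [k']. *)
  exact: (definable_family 5 (h := fun x e => gpt (h x e)) Dh (definable_term_var _ 1)).
by dfn; apply: Dw.
Qed.

Lemma sum_graph0 h z : sum_graph h zero z <-> z = gpt 0.
Proof.
split=> [[u [uP /uP[[]//|[k' [_ [_ [/esym/succ_neq0]]]]]]]//|->].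
have [b bP] := zermelo_add Z zero (opair zero (gpt 0)).
exists b; split; last by apply/bP; right.
by move=> k y /bP[/zeroP//|/(opair_inj Z)[-> ->]]; left.
Qed.

Lemma sum_graphS h n z : natural n -> sum_graph h (succ n) z <->
  exists2 y, sum_graph h n y & z = gpt (gval cG y + h n).
Proof.
move=> nn; split=> [[u [uP /uP[[/succ_neq0]//|[k [y [kn [E [kyu zE]]]]]]]]|].
  by move: (succ_inj nn kn E) kyu zE => <- kyu zE; exists y => //; exists u.
move=> [y [u [uP nyu]] ->].
have [b bP] := zermelo_add Z u (opair (succ n) (gpt (gval cG y + h n))).
exists b; split; last by apply/bP; right.
move=> k x /bP[/uP[[-> ->]|[k' [z' [k'n [-> [k'u ->]]]]]]|/(opair_inj Z)[-> ->]].
- by left.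
- by right; exists k', z'; do !split=> //; apply/bP; left.
- by right; exists n, y; do !split=> //; apply/bP; left.
Qed.

(** A counterpart of [hyperfinite_sum] whose summand is defined on the whole universe, so that the
    sum can itself occur in formulas. *)
Definition bsum h n : G := gval cG (the (gpt 0) (sum_graph h n)).

Lemma definable_bsum (h : S -> (nat -> S) -> G) t :
  definable_term (fun e => gpt (h (e 0%N) (fun n => e n.+1))) ->
  definable_term t -> definable_term (fun e => gpt (bsum (h^~ e) (t e))).
Proof.
move=> Dh Dt; rewrite /bsum; apply: definable_gval; apply: definable_the; first by dfn.
apply: (@definable_sum_graph (fun x e => h x (fun n => e n.+1))).
(* One slot for the argument of [h] and one for the value bound by [the]. *)
- exact: (definable_family 2 (h := fun x e => gpt (h x e)) Dh (definable_term_var _ 0)).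
- exact: definable_term_weaken.
- by dfn.
Qed.

Section Definable.
Variables (h : S -> G) (Dh : definable_term (fun e => gpt (h (e 0%N)))).

Lemma sum_graph_ex n : natural n -> exists g, sum_graph h n (gpt g) /\
  forall z, sum_graph h n z -> z = gpt g.
Proof.
have DS : definable (fun e => sum_graph h (e 0%N) (e 1%N)).
  by apply: (@definable_sum_graph (fun x _ => h x)); dfn.
suff H : forall n, natural n -> exists y, sum_graph h n y /\
    forall z, sum_graph h n z -> z = y.
  move=> nn; have [y [ny yu]] := H _ nn.
  suff [g gE] : exists g, y = gpt g by rewrite gE in ny yu; exists g.
  by case: ny => u [uP /uP[[_ ->]|[? [? [_ [_ [_ ->]]]]]]]; [exists 0|eexists].
apply: natural_ind; first by dfn.
  by exists (gpt 0); split=> [|z /sum_graph0 //]; exact/sum_graph0.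
move=> k kn [y [ky yu]]; exists (gpt (gval cG y + h k)); split.
  by apply/sum_graphS => //; exists y.
by move=> z /(sum_graphS _ _ kn)[x /yu ->].
Qed.

Lemma bsum_graph n : natural n -> sum_graph h n (gpt (bsum h n)) /\
  forall z, sum_graph h n z -> z = gpt (bsum h n).
Proof.
move=> /sum_graph_ex[g [ng gu]].
by rewrite /bsum (the_eq _ ng gu) gptK.
Qed.

Lemma bsum0 : bsum h zero = 0.
Proof.
have [+ _] := bsum_graph (natural_zero Z).
by move=> /sum_graph0 /gpt_inj.
Qed.

Lemma bsumS n : natural n -> bsum h (succ n) = bsum h n + h n.
Proof.
move=> nn; have [+ _] := bsum_graph (natural_succ Z nn).
by move=> /(sum_graphS _ _ nn)[y /(bsum_graph nn).2 -> /gpt_inj ->]; rewrite gptK.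
Qed.

End Definable.
End Sums.

Ltac dfn_hook_sum ::= lazymatch goal with
  | |- definable_term (fun e => gpt _ (bsum _ _ _ _)) => apply: definable_bsum
  end.

(** * Additivity of hyperfinite sums and independence of the presentation *)

Section SumTheory.
Variables (S : set_structure) (Z : zermelo S).
Variables (G : zmodType) (cG : abelian_group_in S G).
Local Notation gpt := (gpt cG).
Local Notation zero := (zero Z).
Local Notation succ := (succ Z).
Local Notation bsum := (bsum Z cG).
Implicit Types (h : S -> G).

Lemma eq_bsum h h' n : definable_term (fun e => gpt (h (e 0%N))) ->
  definable_term (fun e => gpt (h' (e 0%N))) -> natural n ->
  (forall k, k ∈ n -> h k = h' k) -> bsum h n = bsum h' n.
Proof.
move=> Dh Dh'; move: n; apply: (natural_ind (Z := Z)); first by dfn.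
  by rewrite !bsum0.
move=> n nn IH hh'; rewrite !bsumS // IH.
  by rewrite hh' //; apply/mem_succ; right.
by move=> k kn; apply: hh'; apply/mem_succ; left.
Qed.

Lemma bsumD h h' n : definable_term (fun e => gpt (h (e 0%N))) ->
  definable_term (fun e => gpt (h' (e 0%N))) -> natural n ->
  bsum (fun k => h k + h' k) n = bsum h n + bsum h' n.
Proof.
move=> Dh Dh'; have Dhh' : definable_term (fun e => gpt (h (e 0%N) + h' (e 0%N))) by dfn.
move: n; apply: (natural_ind (Z := Z)); first by dfn.
  by rewrite !bsum0 // addr0.
by move=> n nn IH; rewrite !bsumS // IH addrACA.
Qed.

Lemma bsum_additive (phi : G -> G) h n :
  definable_term (fun e => gpt (h (e 0%N))) ->
  definable_term (fun e => gpt (phi (gval cG (e 0%N)))) ->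
  (forall x y, phi (x + y) = phi x + phi y) -> natural n ->
  bsum (fun k => phi (h k)) n = phi (bsum h n).
Proof.
move=> Dh Dphi phiD.
have Dphi' (f : (nat -> S) -> G) : definable_term (fun e => gpt (f e)) ->
    definable_term (fun e => gpt (phi (f e))).
  move=> Df; have -> : (fun e => gpt (phi (f e))) = (fun e => gpt (phi (gval cG (gpt (f e))))).
    by apply/funext => e; rewrite gptK.
  exact: (@definable_term_app1 _ (fun x => gpt (phi (gval cG x)))).
have Dphih : definable_term (fun e => gpt (phi (h (e 0%N)))) by exact: Dphi'.
have phi0 : phi 0 = 0 by apply: (addrI (phi 0)); rewrite -phiD !addr0.
move: n; apply: (natural_ind (Z := Z)).
- by dfn; apply: Dphi'; dfn.
- by rewrite !bsum0 // phi0.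
by move=> n nn IH; rewrite !bsumS // IH phiD.
Qed.

Lemma bsum_eq0 n : natural n -> bsum (fun _ => 0) n = 0.
Proof.
move: n; apply: (natural_ind (Z := Z)); first by dfn.
  by rewrite bsum0 //; dfn.
by move=> n nn IH; rewrite bsumS ?IH ?addr0 //; dfn.
Qed.

(* Two formal sums of the same chain have the same image under an internal
   additive map: after the terms whose simplex lies in A are discarded, the
   two images still differ by the same amount, because the terms with a given
   simplex add up to the same coefficient on both sides.  Hence the simplices
   of both sums can be discarded one by one. *)
Lemma bsum_welldef (Phi : S -> G -> G) n n' h h' (s s' : S -> S) :
  definable_term (fun e => gpt (Phi (e 0%N) (gval cG (e 1%N)))) ->
  (forall x g g', Phi x (g + g') = Phi x g + Phi x g') ->
  natural n -> natural n' ->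
  definable_term (fun e => gpt (h (e 0%N))) ->
  definable_term (fun e => gpt (h' (e 0%N))) ->
  definable_term (fun e => s (e 0%N)) -> definable_term (fun e => s' (e 0%N)) ->
  (forall x, bsum (fun k => if `[< s k = x >] then h k else 0) n =
             bsum (fun k => if `[< s' k = x >] then h' k else 0) n') ->
  bsum (fun k => Phi (s k) (h k)) n = bsum (fun k => Phi (s' k) (h' k)) n'.
Proof.
move=> DPhi0 PhiD nn nn' Dh Dh' Ds Ds' E.
have DPhi (t : (nat -> S) -> S) (f : (nat -> S) -> G) :
    definable_term t -> definable_term (fun e => gpt (f e)) ->
    definable_term (fun e => gpt (Phi (t e) (f e))).
  move=> Dt Df; have -> : (fun e => gpt (Phi (t e) (f e))) =
      (fun e => gpt (Phi (t e) (gval cG (gpt (f e))))).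
    by apply/funext => e; rewrite gptK.
  exact: (@definable_term_app2 _ (fun x y => gpt (Phi x (gval cG y)))).
pose part (A : S -> Prop) (r : S -> S) (g : S -> G) m :=
  bsum (fun k => if `[< A (r k) >] then Phi (r k) (g k) else 0) m.
have partU A t r g m : definable (fun e => A (e 0%N)) ->
    definable_term (fun e => r (e 0%N)) ->
    definable_term (fun e => gpt (g (e 0%N))) -> natural m -> ~ A t ->
    part (fun x => A x \/ x = t) r g m = part A r g m +
      Phi t (bsum (fun k => if `[< r k = t >] then g k else 0) m).
  move=> DA Dr Dg nm nAt; rewrite /part.
  rewrite -(bsum_additive (phi := Phi t)) //; last 2 first.
    by dfn.
    by apply: DPhi; dfn.
  rewrite -bsumD //; last 2 first.
    by dfn; apply: DPhi; dfn.
    by apply: DPhi; dfn.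
  congr (bsum _ m); apply/funext => k.
  have Phi0 : Phi t 0 = 0 by apply: (addrI (Phi t 0)); rewrite -PhiD !addr0.
  case: (asboolP (r k = t)) => [rk|rk].
    rewrite rk; case: asboolP => [_|[]]; last by right.
    by case: asboolP => // _; rewrite add0r.
  rewrite Phi0 addr0; case: asboolP => [[a|//]|na]; first by case: asboolP.
  by case: asboolP => // a; case: na; left.
pose good A := part A s h n = part A s' h' n'.
have goodU A t : definable (fun e => A (e 0%N)) -> good A ->
    good (fun x => A x \/ x = t).
  move=> DA gA; have [At|nAt] := pselect (A t); last by rewrite /good !partU // gA E.
  suff -> : (fun x => A x \/ x = t) = A by [].
  by apply/funext => x; apply/propext; split=> [[//|->]|]; [exact: At|left].
have goodE A r m : definable (fun e => A (e 0%N)) ->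
    definable_term (fun e => r (e 0%N)) -> natural m -> good A ->
    good (fun x => A x \/ exists2 k, k ∈ m & x = r k).
  move=> DA Dr nm gA; move: m nm; apply: (natural_ind (Z := Z)).
  - by rewrite /good /part; dfn; apply: DPhi; dfn.
  - suff -> : (fun x => A x \/ exists2 k, k ∈ zero & x = r k) = A by [].
    by apply/funext => x; apply/propext; split=> [[//|[k /zeroP//]]|]; left.
  move=> m nm /(goodU _ (r m)) H.
  have -> : (fun x => A x \/ exists2 k, k ∈ succ m & x = r k) =
     (fun x => (A x \/ exists2 k, k ∈ m & x = r k) \/ x = r m).
    apply/funext => x; apply/propext; split.
      by move=> [a|[k /mem_succ[km|->] xE]];
        [left; left|left; right; exists k|right].
    move=> [[a|[k km xE]]|xE]; [by left|right; exists k => //|right; exists m => //].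
      by apply/mem_succ; left.
    by apply/mem_succ; right.
  by apply: H; dfn.
have good0 : good (fun _ => False).
  by rewrite /good /part !asboolF ?bsum_eq0 // => -[].
(* Starting from the empty set, all simplices of [s] and then all those of [s'] are added; the
   restriction to the resulting set is vacuous on both sides. *)
have := goodE _ s' n' _ Ds' nn' (goodE _ s n _ Ds nn good0).
rewrite /good /part => H; rewrite (_ : bsum _ n = bsum (fun k =>
   if `[< (False \/ exists2 i, i ∈ n & s k = s i) \/ exists2 i, i ∈ n' & s k = s' i >]
   then Phi (s k) (h k) else 0) n); last first.
  apply: eq_bsum => //; first by apply: DPhi; dfn.
    by dfn; apply: DPhi; dfn.
  by move=> k kn; rewrite asboolT //; left; right; exists k.
rewrite H; first last.
- by dfn.
- by dfn.
apply: eq_bsum => //; last 2 first.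
- by apply: DPhi; dfn.
- by move=> k kn; rewrite asboolT //; right; exists k.
by dfn; apply: DPhi; dfn.
Qed.

End SumTheory.

(** * Formal sums and linear extension *)

Lemma eq_El (S : set_structure) (a : S) (x y : El a) : El_val x = El_val y -> x = y.
Proof.
case: x y => [x xa] [y ya] /= E; case: y / E ya => ya.
by rewrite (Prop_irrelevance xa ya).
Qed.

Section InternalMaps.
Variables (S : set_structure) (Z : zermelo S) (n : S).
Variables (B : Type) (cB : B -> S).

Lemma internal_map_app (f : El n -> B) : internal_map (@El_val _ n) cB f ->
  exists a, forall k, cB (f k) = app a (El_val k).
Proof.
move=> [a aP]; exists a => k; apply/esym; apply: the_eq; first by apply/aP; exists k.
by move=> z /aP[k' _ /(opair_inj Z)[/eq_El -> ->]].
Qed.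

Lemma definable_internal_map (h : S -> S) (f : El n -> B) :
  natural n -> definable_term (fun e => h (e 0%N)) ->
  (forall k, cB (f k) = h (El_val k)) -> internal_map (@El_val _ n) cB f.
Proof.
move=> nn Dh fh; have [a aP] := exists_graph Z Dh nn.
exists a => z; rewrite aP; split=> [[k kn ->]|[k _ ->]].
  by exists (exist (fun x => x ∈ n) k kn) => //; rewrite fh.
by exists (El_val k); [exact: (proj2_sig k)|rewrite fh].
Qed.

End InternalMaps.

Section FormalSums.
Variables (F : nonstandard_framework) (X : uniformType).
Variables (cX : uniform_in (standard F) X).
Variables (G : zmodType) (cG : abelian_group_in (internal F) G).
Local Notation S := (internal F).
Let Z := internal_zermelo F.
Local Notation gpt := (gpt cG).
Local Notation bsum := (bsum Z cG).
Local Notation code := (@simplex_code F X cX _).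

Lemma hyperfinite_sumP (n : S) (g : El n -> G) (h : S -> G) v :
  natural n -> definable_term (fun e => gpt (h (e 0%N))) ->
  (forall k, g k = h (El_val k)) -> hyperfinite_sum cG g v <-> v = bsum h n.
Proof.
move=> nn Dh gh; split.
  move=> [u [n' [[/(is_succE Z) -> ui] u0 uS ->]]].
  have [a uia] := internal_map_app Z ui.
  have ua k : k ∈ succ Z n -> app a k = gpt (u k).
    by move=> kSn; rewrite -(uia (exist (fun x => x ∈ succ Z n) k kSn)).
  have nSn : n ∈ succ Z n by apply/mem_succ; right.
  (* The function [u] is arbitrary outside [succ Z n]; the induction therefore runs on the graph [a]
     of its restriction, which is internal. *)
  have H : forall k, natural k -> k ∈ succ Z n -> app a k = gpt (bsum h k).
    apply: (natural_ind (Z := Z)); first by dfn.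
      by move=> /ua ->; rewrite bsum0 // (u0 _ (@zeroP _ Z)).
    move=> k nk IH Skn; rewrite bsumS //.
    have kn : k ∈ n := mem_succ_succ nn Skn.
    have kSn : k ∈ succ Z n by apply/mem_succ; left.
    rewrite ua // (uS (exist (fun x => x ∈ n) k kn)) ?gh; last exact: succP.
    by congr (gpt (_ + _)); apply: (@gpt_inj _ _ cG); rewrite -IH // ua.
  by apply: (@gpt_inj _ _ cG); rewrite -H // ua.
move=> ->; exists (bsum h), (succ Z n); split=> //.
- split; first exact: succP.
  apply: (@definable_internal_map _ Z _ _ _ (fun k => gpt (bsum h k))) => //.
  + exact: natural_succ.
  + by dfn.
- by move=> z /(is_empty_zero Z) ->; rewrite bsum0.
- move=> k k' /(is_succE Z) ->; rewrite bsumS ?gh //.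
  exact: (mem_natural Z nn (proj2_sig k)).
Qed.

(** Codes are left-nested pairs, so they are unwound from the last vertex; the common length of the
    two tuples makes this unambiguous. *)
Lemma simplex_code_inj p : injective (@simplex_code F X cX p).
Proof.
move=> t t' tt'; apply/val_inj; move: tt'.
rewrite /simplex_code (tuple_eta t) (tuple_eta t') !theadE /=.
set x := thead t; set y := thead t'.
have : size (behead t) = size (behead t') by rewrite !size_tuple.
elim/last_ind: (behead t) (behead t') => [|r a IH] r'; case/lastP: r' => [|r' b].
- by move=> _ /= /eq_El ->.
- by rewrite size_rcons.
- by rewrite size_rcons.
rewrite !size_rcons => -[/IH{}IH]; rewrite !map_rcons !foldl_rcons.
by move=> /(opair_inj Z)[/IH [-> ->] /eq_El ->].
Qed.

(** A working form of [formal_sum]: coefficients and codes of simplices are functions on the whole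
    universe, to which [bsum] applies; their values matter only on [n]. *)
Definition definable_sum p (n : S) (h : S -> G) (s : S -> S) (c : chain cX G p) :=
  [/\ natural n, definable_term (fun e => gpt (h (e 0%N))),
      definable_term (fun e => s (e 0%N)),
      forall k, k ∈ n -> exists t : simplex cX p, s k = code t &
      forall t, c t = bsum (fun k => if `[< s k = code t >] then h k else 0) n].

Lemma single_code p (g : G) (s t : simplex cX p) a : a = code s ->
  single g s t = if `[< a = code t >] then g else 0.
Proof.
move=> ->; rewrite /single; congr (if _ then _ else _).
by apply/asbool_equiv_eq; split=> [->|/simplex_code_inj].
Qed.

Lemma formal_sum_definable p n g s (c : chain cX G p) :
  formal_sum cG g s c -> exists h r,
  [/\ forall k : El n, g k = h (El_val k),
      forall k, code (s k) = r (El_val k) & definable_sum n h r c].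
Proof.
move=> [nn gi si cE].
have [a ga] := internal_map_app Z gi; have [b sb] := internal_map_app Z si.
have gE k : g k = gval cG (app a (El_val k)) by rewrite -ga gptK.
exists (fun k => gval cG (app a k)), (app b); split=> //; split=> //; try by dfn.
  by move=> k kn; exists (s (exist (fun x => x ∈ n) k kn)); rewrite sb.
move=> t; apply/(@hyperfinite_sumP n (fun k => single (g k) (s k) t)) => //; first by dfn.
by move=> k; rewrite (single_code _ _ (esym (sb k))) gE.
Qed.

Lemma definable_formal_sum p n h r (c : chain cX G p) :
  definable_sum n h r c -> exists g s,
  [/\ forall k : El n, g k = h (El_val k),
      forall k : El n, code (s k) = r (El_val k) & formal_sum cG g s c].
Proof.
move=> [nn Dh Dr rP cE].
pose s (k : El n) := sval (cid (rP _ (proj2_sig k))).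
have sE k : code (s k) = r (El_val k) by rewrite /s; case: cid => t /= <-.
exists (fun k => h (El_val k)), s; split=> //; split=> //.
- exact: (@definable_internal_map _ Z _ _ _ (fun k => gpt (h k))).
- exact: (@definable_internal_map _ Z _ _ _ r).
move=> t; apply/(@hyperfinite_sumP n _
  (fun k => if `[< r k = code t >] then h k else 0)) => //; first by dfn.
by move=> k; rewrite (single_code _ _ (esym (sE k))).
Qed.

(** The set from which [linear_extension] chooses is a singleton, by [bsum_welldef]. *)
Lemma linear_extensionE p (phi : simplex cX p -> G -> G) (Phi : S -> G -> G)
    n h r c :
  definable_term (fun e => gpt (Phi (e 0%N) (gval cG (e 1%N)))) ->
  (forall x g g', Phi x (g + g') = Phi x g + Phi x g') ->
  (forall t g, phi t g = Phi (code t) g) ->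
  definable_sum n h r c ->
  linear_extension cG phi c = bsum (fun k => Phi (r k) (h k)) n.
Proof.
move=> DPhi PhiD phiE nhrc.
have DPhi' h' r' : definable_term (fun e => gpt (h' (e 0%N))) ->
    definable_term (fun e => r' (e 0%N)) ->
    definable_term (fun e => gpt (Phi (r' (e 0%N)) (h' (e 0%N)))).
  move=> Dh Dr.
  have -> : (fun e : nat -> S => gpt (Phi (r' (e 0%N)) (h' (e 0%N)))) =
      (fun e => gpt (Phi (r' (e 0%N)) (gval cG (gpt (h' (e 0%N)))))).
    by apply/funext => e; rewrite gptK.
  exact: (@definable_term_app2 _ (fun x y => gpt (Phi x (gval cG y)))).
have [nn Dh Dr rP cE] := nhrc.
apply: xget_unique.
  have [g [s [gh sr gsc]]] := definable_formal_sum nhrc.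
  exists n, g, s; split=> //; apply/(@hyperfinite_sumP n _ (fun k => Phi (r k) (h k))) => //.
    exact: DPhi'.
  by move=> k; rewrite phiE sr gh.
move=> v [n' [g [s [/formal_sum_definable[h' [r' [gh sr [nn' Dh' Dr' rP' cE']]]]]]]].
move=> /(@hyperfinite_sumP n' _ (fun k => Phi (r' k) (h' k)))/= ->; last 3 first.
- by [].
- exact: DPhi'.
- by move=> k; rewrite phiE sr gh.
apply: bsum_welldef => // x.
(* Coefficients are compared at every [x] of the universe; where [x] codes no simplex, both
   vanish. *)
have [[t xt]|nx] := pselect (exists t : simplex cX p, x = code t).
  by rewrite xt -cE -cE'.
have H m q w : natural m -> definable_term (fun e => gpt (q (e 0%N))) ->
    definable_term (fun e => w (e 0%N)) ->
    (forall k, k ∈ m -> exists t : simplex cX p, w k = code t) ->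
    bsum (fun k => if `[< w k = x >] then q k else 0) m = 0.
  move=> nm Dq Dw wP; apply: etrans (bsum_eq0 Z cG nm).
  apply: eq_bsum => //; try by dfn.
  move=> k /wP[t wt]; case: asboolP => // wx; case: nx; exists t.
  by rewrite -wx.
by rewrite !H.
Qed.

End FormalSums.

(** * Boundaries of internal chains *)

Section Boundaries.
Variables (F : nonstandard_framework) (X : uniformType).
Variables (cX : uniform_in (standard F) X).
Variables (G : zmodType) (cG : abelian_group_in (internal F) G).
Local Notation S := (internal F).
Let Z := internal_zermelo F.
Local Notation gpt := (gpt cG).
Local Notation bsum := (bsum Z cG).
Local Notation X' := (star (Defs.space cX)).
Implicit Types (R : S -> S -> Prop) (beta : S -> G).

Definition near_codes (y z : S) : Prop :=
  forall E, entourage E -> opair y z ∈ star (ent cX E).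

Lemma simplex_code0 (t : simplex cX 0) : simplex_code t = El_val (tnth t ord0).
Proof. by case/tupleP: t => x t; rewrite tuple0 /simplex_code theadE. Qed.

Lemma simplex_code1 (t : simplex cX 1) :
  simplex_code t = opair (El_val (tnth t ord0)) (El_val (tnth t ord_max)).
Proof.
case/tupleP: t => x t; case/tupleP: t => y t; rewrite tuple0.
by rewrite /simplex_code theadE /= !(tnth_nth x).
Qed.

Lemma code0_space (t : simplex cX 0) : simplex_code t ∈ X'.
Proof. by rewrite simplex_code0; exact: (proj2_sig (tnth t ord0)). Qed.

(** The coefficient at [t] of the boundary of [g] times the edge coded by [x]. Deleting the first
    vertex leaves the endpoint, hence its positive sign. *)
Definition edge_boundary (t x : S) (g : G) : G :=
  (if `[< exists a, x = opair a t >] then g else 0) -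
  (if `[< exists b, x = opair t b >] then g else 0).

Lemma edge_boundary_opair t a b g : edge_boundary t (opair a b) g =
  (if `[< b = t >] then g else 0) - (if `[< a = t >] then g else 0).
Proof.
rewrite /edge_boundary; congr (_ - _); congr (if _ then _ else _).
  apply: asbool_equiv_eq; split=> [[c /(opair_inj Z)[_ ->]]|->] //; by exists a.
apply: asbool_equiv_eq; split=> [[c /(opair_inj Z)[->]]|->] //; by exists b.
Qed.

Lemma edge_boundaryD t x g g' :
  edge_boundary t x (g + g') = edge_boundary t x g + edge_boundary t x g'.
Proof.
by rewrite /edge_boundary; case: asboolP; case: asboolP => _ _;
  rewrite ?subr0 ?sub0r ?subrr ?addr0 ?opprD.
Qed.

Lemma boundaryE n h r (c : chain cX G 1) t : definable_sum cG n h r c ->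
  Defs.boundary cG c t =
  bsum (fun k => edge_boundary (simplex_code t) (r k) (h k)) n.
Proof.
move=> nhrc; apply: linear_extensionE nhrc.
- by rewrite /edge_boundary; dfn.
- exact: edge_boundaryD.
move=> s g; rewrite /simplex_boundary !big_ord_recl big_ord0 addr0.
rewrite simplex_code1 edge_boundary_opair expr0 expr1 mulr1z mulrN1z.
congr (_ - _).
  by apply: single_code; rewrite simplex_code0 tnth_mktuple;
    congr (El_val (tnth _ _)); exact/val_inj.
by apply: single_code; rewrite simplex_code0 tnth_mktuple;
    congr (El_val (tnth _ _)); exact/val_inj.
Qed.

(* The function beta is the boundary of an internal formal sum of edges, the
   k-th of which joins [app a k] to [app b k]. *)
Definition bounds R beta : Prop := exists m a b h : S,
  [/\ natural m, forall k, k ∈ m -> app a k ∈ X' /\ app b k ∈ X' /\ R (app a k) (app b k) &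
    forall t, t ∈ X' -> bsum (fun k =>
      (if `[< app b k = t >] then gval cG (app h k) else 0) -
      (if `[< app a k = t >] then gval cG (app h k) else 0)) m = beta t].

Lemma eq_bounds R beta beta' :
  (forall t, t ∈ X' -> beta t = beta' t) -> bounds R beta -> bounds R beta'.
Proof.
move=> bb' [m [a [b [h [nm abR E]]]]]; exists m, a, b, h; split=> // t tX.
by rewrite -bb' // E.
Qed.

(** This is the return from the definable [R] to external closeness. Both directions are assumed
    because a microsimplex requires closeness for all ordered pairs of vertices; equal vertices are
    covered by [star_diag]. *)
Lemma bounds_boundaries R beta :
  (forall y z, R y z -> near_codes y z /\ near_codes z y) ->
  bounds R beta -> exists2 c : chain cX G 0, boundaries cG c &
    forall t, c t = beta (simplex_code t).
Proof.
move=> Rnear [m [a [b [h [nm abR E]]]]].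
pose r k := opair (app a k) (app b k).
pose c (t : simplex cX 1) :=
  bsum (fun k => if `[< r k = simplex_code t >] then gval cG (app h k) else 0) m.
have mc : definable_sum cG m (fun k => gval cG (app h k)) r c.
  split=> //; try by rewrite /r; dfn.
  move=> k /abR[aX [bX _]].
  exists [tuple exist (fun x => x ∈ X') _ aX; exist (fun x => x ∈ X') _ bX].
  by rewrite simplex_code1.
exists (Defs.boundary cG c); last first.
  move=> t; rewrite (boundaryE t mc) -E; last exact: code0_space.
  by congr (bsum _ m); apply/funext => k; rewrite edge_boundary_opair.
exists c => //; have [g [s [gh sr gsc]]] := definable_formal_sum mc.
exists m, g, s; split=> // k i j; rewrite /infinitely_close.
have [aX [bX /Rnear[ab ba]]] := abR _ (proj2_sig k).
have := sr k; rewrite simplex_code1 => /(opair_inj Z)[s0 s1].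
have sE (l : 'I_2) : El_val (tnth (s k) l) = app a (El_val k) \/
    El_val (tnth (s k) l) = app b (El_val k).
  case: l => -[|[|//]] lt; [left; rewrite -s0|right; rewrite -s1];
  by congr (El_val (tnth _ _)); exact/val_inj.
by move=> A entA; have [->|->] := sE i; have [->|->] := sE j;
  [exact: star_diag|exact: ab|exact: ba|exact: star_diag].
Qed.

(* The edges of a microchain with boundary c need not lie in W; R adds them to
   W, which keeps it definable since they form an internal sequence. *)
Lemma boundaries_bounds (W : S) (c : chain cX G 0) :
  (forall y z, opair y z ∈ W -> near_codes y z /\ near_codes z y) ->
  boundaries cG c -> exists R beta,
  [/\ definable (fun e => R (e 0%N) (e 1%N)),
      definable_term (fun e => gpt (beta (e 0%N))),
      forall y z, opair y z ∈ W -> R y z,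
      forall y z, R y z -> near_codes y z /\ near_codes z y &
      bounds R beta /\ forall t, c t = beta (simplex_code t)].
Proof.
move=> Wnear [d [n [g [s [/formal_sum_definable[h [r [gh sr ndhr]]] smicro]]]] <-].
have [nn Dh Dr _ _] := ndhr.
exists (fun y z => opair y z ∈ W \/ exists2 k, k ∈ n & opair y z = r k).
exists (fun t => bsum (fun k => edge_boundary t (r k) (h k)) n).
split; try by rewrite /edge_boundary; dfn.
- by move=> y z; left.
- move=> y z [/Wnear//|[k kn]].
  rewrite -[k]/(El_val (exist (fun x => x ∈ n) k kn)) -sr simplex_code1.
  by move=> /(opair_inj Z)[-> ->]; split; apply: smicro.
split; last by move=> t; rewrite (boundaryE t ndhr).
pose pr1 (x : S) := the x (fun y => exists z, x = opair y z).
pose pr2 (x : S) := the x (fun z => exists y, x = opair y z).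
have pr1E y z : pr1 (opair y z) = y.
  by apply: the_eq; [exists z|move=> y' [z' /(opair_inj Z)[]]].
have pr2E y z : pr2 (opair y z) = z.
  by apply: the_eq; [exists y|move=> z' [y' /(opair_inj Z)[]]].
have Dpr1 : definable_term (fun e => pr1 (r (e 0%N))) by rewrite /pr1; dfn.
have Dpr2 : definable_term (fun e => pr2 (r (e 0%N))) by rewrite /pr2; dfn.
(* [bounds] quantifies over elements of the universe, so the definable endpoints and coefficients
   are turned into sets of pairs over [n]. *)
have [a aP] := exists_graph Z (h := fun k => pr1 (r k)) Dpr1 nn.
have [b bP] := exists_graph Z (h := fun k => pr2 (r k)) Dpr2 nn.
have [q qP] := exists_graph Z (h := fun k => gpt (h k)) Dh nn.
have aE k kn := @app_graph _ Z (fun k => pr1 (r k)) _ _ k aP kn.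
have bE k kn := @app_graph _ Z (fun k => pr2 (r k)) _ _ k bP kn.
have qE k kn := @app_graph _ Z (fun k => gpt (h k)) _ _ k qP kn.
exists n, a, b, q.
have rE k : k ∈ n -> exists t : simplex cX 1, r k = simplex_code t.
  by case: ndhr => _ _ _ H _; exact: H.
split=> //.
  move=> k kn; rewrite aE // bE //; have [t rk] := rE k kn.
  rewrite rk simplex_code1 pr1E pr2E; split; first exact: (proj2_sig (tnth t ord0)).
  split; first exact: (proj2_sig (tnth t ord_max)).
  by right; exists k => //; rewrite rk simplex_code1.
move=> t tX; apply: eq_bsum => //; try by rewrite /edge_boundary; dfn.
move=> k kn; have [u rk] := rE k kn.
by rewrite aE // bE // qE // gptK rk simplex_code1 pr1E pr2E edge_boundary_opair.
Qed.

Lemma bounds_append R beta y z g :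
  bounds R beta -> y ∈ X' -> z ∈ X' -> R y z ->
  bounds R (fun t => beta t + ((if `[< z = t >] then g else 0) -
                               (if `[< y = t >] then g else 0))).
Proof.
move=> [m [a [b [h [nm abR E]]]]] yX zX Ryz.
(* The old sequences have indices in [m], so the new edge is stored at index [m], the last element
   of [succ Z m]. *)
pose upd (u v k : S) := if `[< k = m >] then v else app u k.
have Dupd u v : definable_term (fun e => upd u v (e 0%N)) by rewrite /upd; dfn.
have nSm := natural_succ Z nm.
have [a' a'P] := exists_graph Z (h := upd a y) (Dupd a y) nSm.
have [b' b'P] := exists_graph Z (h := upd b z) (Dupd b z) nSm.
have [h' h'P] := exists_graph Z (h := upd h (gpt g)) (Dupd h (gpt g)) nSm.
have updE u v u' : (forall x, x ∈ u' <-> exists2 k, k ∈ succ Z m & x = opair k (upd u v k)) ->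
    app u' m = v /\ forall k, k ∈ m -> app u' k = app u k.
  move=> u'P; split=> [|k km]; rewrite (app_graph Z u'P).
  - by rewrite /upd asboolT.
  - by apply/mem_succ; right.
  - by rewrite /upd asboolF // => kE; apply: (natural_irrefl Z nm); rewrite -{1}kE.
  - by apply/mem_succ; left.
have [am aE] := updE _ _ _ a'P; have [bm bE] := updE _ _ _ b'P.
have [hm hE] := updE _ _ _ h'P.
exists (succ Z m), a', b', h'; split=> //.
  by move=> k /mem_succ[km|->]; [rewrite aE // bE //; exact: abR|rewrite am bm].
move=> t tX; rewrite bsumS //; last by dfn.
rewrite am bm hm gptK; congr (_ + _); rewrite -E //.
apply: eq_bsum => //; try by dfn.
by move=> k km; rewrite aE // bE // hE.
Qed.

(** As [bounds] is definable, the admissible endpoints [z] form an internal set. It contains [x],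
    where the added difference vanishes, and appending an edge closes it under [W]-steps. *)
Lemma bounds_chain R beta W x g : chain_connected X ->
  W ∈ star (uniformity cX) -> (forall y z, opair y z ∈ W -> R y z) ->
  definable (fun e => R (e 0%N) (e 1%N)) ->
  definable_term (fun e => gpt (beta (e 0%N))) ->
  bounds R beta -> x ∈ X' -> forall z, z ∈ X' ->
  bounds R (fun t => beta t + ((if `[< z = t >] then g else 0) -
                               (if `[< x = t >] then g else 0))).
Proof.
move=> XC WU WR DR Dbeta Bbeta xX.
pose P z := bounds R (fun t => beta t + ((if `[< z = t >] then g else 0) -
                               (if `[< x = t >] then g else 0))).
have DP : definable (fun e => P (e 0%N)).
  by rewrite /P /bounds; dfn.
have [A AP] := @zermelo_separation _ Z P X' DP.
suff H : forall z, z ∈ X' -> z ∈ A by move=> z /H /AP[].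
apply: (star_chain XC WU _ _ xX).
  move=> y z /AP[yX Py] zX yzW; apply/AP; split=> //.
  apply: eq_bounds (bounds_append g Py yX zX (WR _ _ yzW)) => t tX /=.
  (* Telescoping: the contributions at the intermediate point [y] cancel. *)
  by rewrite -addrA; congr (_ + _); rewrite addrC addrA subrK.
apply/AP; split=> //; apply: eq_bounds Bbeta => t tX.
by rewrite subrr addr0.
Qed.

(** Starting the induction from a boundary [b] instead of 0 yields what the comparison of cosets
    requires, with no need to concatenate two formal sums. *)
Lemma boundaries_add (n : S) (h : S -> G) (r : S -> S) (b c : chain cX G 0) :
  chain_connected X -> definable_sum cG n h r c -> bsum h n = 0 ->
  boundaries cG b -> boundaries cG (b + c).
Proof.
move=> XC [nn Dh Dr rP cE] h0 Bb.
(* If the star of the space is empty, there are no simplices and [b + c = b] holds trivially. *)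
have [[x xX]|nX] := pselect (exists x, x ∈ X'); last first.
  suff -> : b + c = b by [].
  by apply/funext => t; case: nX; exists (simplex_code t); exact: code0_space.
have [W WU Wsmall] := exists_infinitesimal_entourage cX.
have Wnear y z : opair y z ∈ W -> near_codes y z /\ near_codes z y.
  move=> yzW; split=> E entE; first exact: Wsmall.
  (* [W] is not assumed symmetric; it is also contained in the star of every inverse entourage. *)
  by apply: star_ent_inv => //; apply: Wsmall => //; exact: entourage_inv.
have [R [beta [DR Dbeta WR Rnear [Bbeta bE]]]] := boundaries_bounds Wnear Bb.
(* The augmentation of each partial sum is compensated at the base point [x]; at [m = n] the
   correction disappears by [h0]. *)
have H m : natural m -> (forall k, k ∈ m -> r k ∈ X') ->
    bounds R (fun t => beta t + (bsum (fun k => if `[< r k = t >] then h k else 0) m -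
      (if `[< x = t >] then bsum h m else 0))).
  move: m; apply: (natural_ind (Z := Z)).
  - by rewrite /bounds; dfn.
  - move=> _; apply: eq_bounds Bbeta => t tX.
    by rewrite !bsum0 //; [rewrite if_same subrr addr0|dfn].
  move=> m nm IH rX.
  have mSm : m ∈ succ Z m by apply/mem_succ; right.
  have {}IH := IH (fun k km => rX k (iffRL (mem_succ Z k m) (or_introl km))).
  apply: eq_bounds (bounds_chain (h m) XC WU WR DR _ IH xX (rX m mSm)); last by dfn.
  move=> t tX /=; rewrite !bsumS //; last by dfn.
  rewrite -addrA; congr (_ + _); rewrite addrACA; congr (_ + _).
  by case: ifP => _; rewrite ?opprD ?oppr0 ?addr0.
have rX k : k ∈ n -> r k ∈ X'.
  by move=> /rP[t ->]; exact: code0_space.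
have [d Bd dE] := bounds_boundaries Rnear (H n nn rX).
suff -> : b + c = d by [].
apply/funext => t; rewrite dE h0 if_same subr0 -[(b + c) t]/(b t + c t).
by rewrite bE cE.
Qed.

End Boundaries.

(** * Vanishing of reduced homology in degree 0 *)

Theorem theorem8 (F : nonstandard_framework) (X : uniformType)
    (cX : uniform_in (standard F) X)
    (G : zmodType) (cG : abelian_group_in (internal F) G) :
  chain_connected X ->
  reduced_homology cX cG 0 = [set homology_class cX cG (0 : chain cX G 0)].
Proof.
move=> XC; pose Z := internal_zermelo F.
have augE n h r (c : chain cX G 0) : definable_sum cG n h r c ->
    augmentation cG c = bsum Z cG h n.
  by apply: (linear_extensionE (Phi := fun _ g => g)) => //; dfn.
apply/seteqP; split=> [_ [c [[n [g [s [gsc _]]]] c0] <-]|_ ->].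
  have [h [r [_ _ nhrc]]] := formal_sum_definable gsc.
  have [nn Dh Dr rP cE] := nhrc.
  have h0 : bsum Z cG h n = 0 by rewrite -(augE n h r c).
  have DN : definable_term (fun e => gpt cG (- gval cG (e 0%N))) by dfn.
  (* The coset of 0 lies in the coset of [c] because [b - c] is a boundary too, so [- c] must also
     be presented as a formal sum. *)
  have nhrNc : definable_sum cG n (fun k => - h k) r (- c).
    split=> //; first by dfn.
    move=> t; rewrite -[(- c) t]/(- c t) cE.
    have Dhr : definable_term (fun e =>
        gpt cG (if `[< r (e 0%N) = simplex_code t >] then h (e 0%N) else 0)) by dfn.
    apply: etrans (esym (bsum_additive Z Dhr DN (@opprD G) nn)) _.
    by congr (bsum _ _ _ n); apply/funext => k; case: ifP => _; rewrite ?oppr0.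
  apply/seteqP; split=> _ [b Bb <-].
    exists (c + b); last by rewrite add0r.
    by rewrite addrC; exact: boundaries_add nhrc h0 Bb.
  exists (b - c); last by rewrite addrC subrK add0r.
  apply: boundaries_add nhrNc _ Bb => //.
  by rewrite (bsum_additive Z Dh DN (@opprD G) nn) h0 oppr0.
exists 0 => //.
(* The class of 0 really occurs: the empty formal sum presents 0 as a cycle. *)
have nhr0 : definable_sum cG (zero Z) (fun _ => 0) (fun x => x) (0 : chain cX G 0).
  split; [exact: natural_zero|by dfn|by dfn|by move=> k /zeroP|].
  by move=> t; rewrite bsum0 //; dfn.
split; last by rewrite (augE _ _ _ _ nhr0) bsum0 //; dfn.
have [g [s [_ _ gsc]]] := definable_formal_sum nhr0.
by exists (zero Z), g, s; split=> // k; case: (@zeroP _ Z _ (proj2_sig k)).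
Qed.
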